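(* There is a function $l:\mathbb{N}\to(0,\infty)$ such that the following holds. Let $\mathcal{T}=(V,E,T,P_1,P_2,P_3,P_4)$ be a triangulation of a topological planar quadrilateral $Q$, let $F\subset V$ be the set of vertices not on $\partial Q$, let $c$ be a conductance function and let $\bar\Gamma(F)=(\bar F,\bar E,\bar c)$ be the associated network. Let $g>0$ be a constant, let $f$ be the Dirichlet-Neumann boundary value function on $\bar\Gamma(F)$ with constant $g$, let $I(f)$ be its Dirichlet energy, and let $\rho$ be the gradient metric induced by $f$. Let $$M=\max\Big(\{\|\overrightarrow{c}_{F}(x)\| : x\in F\}\cup\{\|\overrightarrow{c}_{\delta(F)}(x)\| : x\in\delta(F)\}\Big),\qquad m=\min_{(x,y)\in\bar E}\sqrt{c(x,y)}.$$ If $\gamma^*$ is a shortest vertically thick path connecting $P_1$ to $P_3$ and $\gamma$ is a shortest horizontally thick path connecting $P_2$ to $P_4$ (that is, of minimal $\rho$-length among all vertically thick, respectively horizontally thick, paths), then $$l(|V|)\,I(f)\ \ge\ \mathrm{length}_\rho(\gamma^* )\,\mathrm{length}_\rho(\gamma)\ \ge\ \frac{m}{M}\,I(f).$$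
   Context: **Triangulated quadrilateral.** A quadrilateral $Q$ is a topological planar closed disk with four distinguished points on its boundary, called corners. A triangulation $\mathcal{T}=(V,E,T,P_1,P_2,P_3,P_4)$ of $Q$ consists of a triangulation of $Q$ with vertices $V$, edges $E$ and triangles $T$ (finite, with simple connected planar $1$-skeleton), together with a decomposition $\partial Q=P_1\cup P_2\cup P_3\cup P_4$ into four non-trivial arcs of the triangulation with disjoint interiors, in cyclic order; if the intersection of any two of the arcs is nonempty, it consists of a corner. All corners are vertices, and, for the purpose of assigning vertices to the sets $P_i$, each corner belongs to one and only one of the $P_i$'s. Below $P_i$ also denotes the corresponding set of vertices. **Network.** A conductance function assigns to each edge $(x,y)$ a number $c(x,y)=c(y,x)>0$. $F$ is the set of vertices not on $\partial Q$; $\delta(F)=\{x\in V\setminus F : (x,y)\in E \text{ for some } y\in F\}$, and it is assumed that $\delta(F)$ is exactly the set of vertices in $P_1\cup P_2\cup P_3\cup P_4$. Set $\bar F=F\cup\delta(F)$ and $\bar E=\{(x,y)\in E : x\in F\}$ (undirected edges with at least one endpoint in $F$, each counted once); $\bar\Gamma(F)=(\bar F,\bar E,\bar c)$ with $\bar c=c|_{\bar E}$. Write $x\sim y$ if $(x,y)\in\bar E$; thus for $x\in\delta(F)$ the neighbors are taken only from $F$. **Potential, energy, normal derivative.** For $u:\bar F\to[0,\infty)$: $\Delta u(x)=\sum_{y\sim x}c(x,y)(u(x)-u(y))$; $u$ is harmonic in $F$ if $\Delta u(x)=0$ for all $x\in F$; the Dirichlet energy is $I(u)=\sum_{(x,y)\in\bar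 E}c(x,y)(u(x)-u(y))^2$; the normal derivative at $x\in\delta(F)$ is $\frac{\partial u}{\partial n_F}(x)=\sum_{y\sim x,\,y\in F}c(x,y)(u(x)-u(y))$. **Dirichlet-Neumann boundary value function** with constant $g>0$: a function $f:\bar F\to[0,\infty)$ that is harmonic in $F$, with $f|_{P_2}=0$, $f|_{P_4}=g$, and $\frac{\partial f}{\partial n_F}=0$ on $P_1$ and on $P_3$. **Vectors and norms.** For $x\in\bar F$, vectors indexed by the edges $(x,y)$, $y\sim x$, carry the inner product $(a,b)=\sum_{y\sim x}\frac{a(x,y)b(x,y)}{c(x,y)}$ with associated norm $\|\cdot\|$. The conductance vector, denoted $\overrightarrow{c}_F(x)$ for $x\in F$ and $\overrightarrow{c}_{\delta(F)}(x)$ for $x\in\delta(F)$, is $(c(x,y))_{y\sim x}$; so its norm is $\big(\sum_{y\sim x}c(x,y)\big)^{1/2}$. For $x\in F$, $\overrightarrow{df}(x)=(c(x,y)(f(y)-f(x)))_{y\sim x}$, and for $x\in\delta(F)$, $\overrightarrow{\frac{\partial f}{\partial n_F}}(x)=(c(x,y)(f(x)-f(y)))_{y\sim x}$. **Gradient metric.** $\rho:\bar F\to[0,\infty)$ is $\rho(x)=\|\overrightarrow{df}(x)\|$ for $x\in F$ and $\rho(x)=\|\overrightarrow{\frac{\partial f}{\partial n_F}}(x)\|$ for $x\in\delta(F)$; equivalently $\rho(x)=\big(\sum_{y\sim x}c(x,y)(f(x)-f(y))^2\big)^{1/2}$ for all $x\in\bar F$. The $\rho$-length of a path $\alpha$ (a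 finite sequence of vertices, consecutive ones adjacent in $\bar\Gamma(F)$) is $\mathrm{length}_\rho(\alpha)=\sum_{x\in\alpha}\rho(x)$. $\mathrm{dist}$ denotes the combinatorial distance (minimal number of edges of a path), also used for distance to a set of vertices. **Thick paths.** A path $\beta=(x_0,x_1,\dots,x_n)$ is vertically thick (respectively horizontally thick) if: (1) $\beta\cap P_3=\{x_0\}$ and $\beta\cap P_1=\{x_n\}$ (respectively $\beta\cap P_2=\{x_0\}$ and $\beta\cap P_4=\{x_n\}$); (2) neither $x_0$ nor $x_n$ is a corner; (3) $x_i\in F$ for all $i=1,\dots,n-1$; (4) $\mathrm{dist}(x_i,P_3\cup P_4\cup P_1)>1$ for all $i=2,\dots,n-2$; (5) for all $x\in P_1\cup P_3\cup P_4$ (respectively for all $x\in\delta(F)$), $\mathrm{dist}(x_1,x)\ge1$ and $\mathrm{dist}(x_{n-1},x)\ge 1$, where $\mathrm{dist}(x_1,x)=1$ only for $x=x_0$ and $\mathrm{dist}(x_{n-1},x)=1$ only for $x=x_n$. *)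

(* Defs.v *)
From HB Require Import structures.
From mathcomp Require Export all_boot all_order all_algebra.
From mathcomp Require Export all_classical all_reals all_analysis.
Set Implicit Arguments.
Unset Strict Implicit.
Unset Printing Implicit Defensive.
Import Order.TTheory GRing.Theory Num.Theory.
Import numFieldNormedType.Exports.
Local Open Scope classical_set_scope.
Local Open Scope ring_scope.

Definition homeomorphism {X Y : topologicalType} (A : set X) (B : set Y)
    (h : X -> Y) : Prop :=
  exists k : Y -> X,
    [/\ {within A, continuous h} /\ {within B, continuous k},
        forall x, A x -> B (h x),
        forall y, B y -> A (k y),
        forall x, A x -> k (h x) = x
      & forall y, B y -> h (k y) = y].

Definition unit_disk (R : realType) : set (R * R) :=
  [set z | z.1 ^+ 2 + z.2 ^+ 2 <= 1].

Definition unit_circle (R : realType) : set (R * R) :=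
  [set z | z.1 ^+ 2 + z.2 ^+ 2 = 1].

(** * Geometric realization of a 2-complex *)

Section Realization.
Variables (R : realType) (V : finType) (adj : rel V) (tris : {set {set V}}).

Definition edge_faces : {set {set V}} :=
  [set S : {set V} | [exists x, exists y, adj x y && (S == [set x; y]%SET)]]%SET.

Definition faces : {set {set V}} :=
  ([set [set x] | x : V] :|: edge_faces :|: tris)%SET.

Definition supp (w : {ptws V -> R}) : {set V} := [set v | w v != 0]%SET.

(* Points are given by barycentric coordinates, with the topology of R^V. *)
Definition realization : set {ptws V -> R} :=
  [set w | [/\ forall v, 0 <= w v, \sum_v w v = 1 & supp w \in faces]].

Definition closed_face (S : {set V}) : set {ptws V -> R} :=
  [set w | realization w /\ supp w \subset S].

Definition vertex_point (v : V) : {ptws V -> R} := fun x => (x == v)%:R.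

End Realization.

(** * Triangulated quadrilaterals *)

(* The arcs P_1, P_2, P_3, P_4 are indexed by 0, 1, 2, 3 in 'I_4. *)
Record quad_triangulation (R : realType) (V : finType) := QuadTriangulation {
  (* 1-skeleton and triangles; as the 1-skeleton is simple, edges and triangles
     are determined by their vertices *)
  adj : rel V;
  adj_sym : symmetric adj;
  adj_irr : irreflexive adj;
  adj_connected : forall x y, connect adj x y;
  tris : {set {set V}};
  trisP : forall t, t \in tris ->
    #|t| = 3%N /\ {in t &, forall x y, x != y -> adj x y};
  (* the planar closed disk Q and the triangulation |K| -> Q *)
  quad : set (R * R);
  disk_map : R * R -> R * R;
  disk_mapP : homeomorphism (@unit_disk R) quad disk_map;
  tri_map : {ptws V -> R} -> R * R;
  tri_mapP : homeomorphism (@realization R V adj tris) quad tri_map;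
  (* a simple closed parametrization of the boundary of Q; the i-th arc is the
     image of [i, i + 1] and the corners are the images of 0, 1, 2, 3, so that
     the arcs are nondegenerate, in cyclic order, and meet only at corners *)
  bd_loop : R -> R * R;
  bd_loop_cont : {within `[0, 4], continuous bd_loop};
  bd_loop_inj : set_inj `[0, 4[ bd_loop;
  bd_loop_closed : bd_loop 0 = bd_loop 4;
  bd_loop_image : bd_loop @` `[0, 4] = disk_map @` @unit_circle R;
  corner_vertex : forall i : 'I_4,
    exists v, tri_map (vertex_point R v) = bd_loop i%:R;
  arc_edges : forall i : 'I_4, exists2 A : {set {set V}},
    A \subset edge_faces adj &
    bd_loop @` `[i%:R, i.+1%:R] =
      tri_map @` \bigcup_(S in [set` A]) @closed_face R V adj tris S;
  (* vertex sets of the arcs: each corner is assigned to exactly one of the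
     two arcs that contain it *)
  side : 'I_4 -> {set V};
  side_arc : forall i v, v \in side i ->
    (bd_loop @` `[i%:R, i.+1%:R]) (tri_map (vertex_point R v));
  side_disjoint : forall i j, i != j -> [disjoint side i & side j]%bool;
  side_cover : forall v,
    (disk_map @` @unit_circle R) (tri_map (vertex_point R v)) ->
    exists i, v \in side i
}.

Section Network.
Variables (R : realType) (V : finType) (T : quad_triangulation R V).

Definition boundary : set (R * R) := disk_map T @` @unit_circle R.

Definition P1 : {set V} := side T (@Ordinal 4 0 isT).
Definition P2 : {set V} := side T (@Ordinal 4 1 isT).
Definition P3 : {set V} := side T (@Ordinal 4 2 isT).
Definition P4 : {set V} := side T (@Ordinal 4 3 isT).

Definition is_corner (v : V) : Prop :=
  exists i : 'I_4, tri_map T (vertex_point R v) = bd_loop T i%:R.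

Definition F : {set V} :=
  [set v | ~~ `[< boundary (tri_map T (vertex_point R v)) >]]%SET.

Definition deltaF : {set V} :=
  [set x | (x \notin F) && [exists y, (y \in F) && adj T x y]]%SET.

Definition barF : {set V} := (F :|: deltaF)%SET.

Definition conductance (c : V -> V -> R) : Prop :=
  forall x y, adj T x y -> c x y = c y x /\ 0 < c x y.

(* adjacency in the network, written ~ in the paper *)
Definition nadj : rel V :=
  [rel x y | adj T x y && ((x \in F) || (y \in F))].

Section Analysis.
Variable c : V -> V -> R.

Definition laplacian (u : V -> R) (x : V) : R :=
  \sum_(y | nadj x y) c x y * (u x - u y).

Definition harmonic_inF (u : V -> R) : Prop :=
  forall x, x \in F -> laplacian u x = 0.

(* every undirected edge occurs as two ordered pairs *)
Definition energy (u : V -> R) : R :=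
  2^-1 * \sum_x \sum_(y | nadj x y) c x y * (u x - u y) ^+ 2.

Definition normal_derivative (u : V -> R) (x : V) : R :=
  \sum_(y | nadj x y && (y \in F)) c x y * (u x - u y).

(* Functions on barF are represented by functions on V; only the values on
   barF are used. *)
Definition DN_boundary_value_function (g : R) (f : V -> R) : Prop :=
  (forall x, x \in barF -> 0 <= f x) /\
  harmonic_inF f /\
  (forall x, x \in P2 -> f x = 0) /\
  (forall x, x \in P4 -> f x = g) /\
  (forall x, x \in (P1 :|: P3)%SET -> normal_derivative f x = 0).

(* A vector at x is a function of y; only its entries with x ~ y are used. *)
Definition inner_at (x : V) (a b : V -> R) : R :=
  \sum_(y | nadj x y) a y * b y / c x y.

Definition norm_at (x : V) (a : V -> R) : R := Num.sqrt (inner_at x a a).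

Definition conductance_vector (x : V) : V -> R := c x.

Definition df_vector (f : V -> R) (x : V) : V -> R :=
  fun y => c x y * (f y - f x).

Definition dn_vector (f : V -> R) (x : V) : V -> R :=
  fun y => c x y * (f x - f y).

Definition gradient_metric (f : V -> R) (x : V) : R :=
  if x \in F then norm_at x (df_vector f x) else norm_at x (dn_vector f x).

Definition conductance_norms : set R :=
  [set norm_at x (conductance_vector x) | x in [set` F]] `|`
  [set norm_at x (conductance_vector x) | x in [set` deltaF]].

Definition sqrt_conductances : set R :=
  [set r | exists x y, nadj x y /\ r = Num.sqrt (c x y)].

End Analysis.

Definition rho_length (rho : V -> R) (s : seq V) : R := \sum_(x <- s) rho x.

(* Combinatorial distance in the network. Finite distances are < #|V|; the
   value #|V| stands for an infinite distance. *)
Definition ndist (x y : V) : nat :=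
  find (fun n => [exists p : n.-tuple V, path nadj x p && (last x p == y)])
       (iota 0 #|V|).

Definition ndist_set (x : V) (A : {set V}) : nat :=
  \big[minn/#|V|]_(y in A) ndist x y.

(* The path (x_0, ..., x_n) is x0 :: p with n = size p. [A] and [B] are the
   sets containing its endpoints, [D] is the set used in condition (5). *)
Definition thick_path (A B D : {set V}) (x0 : V) (p : seq V) : Prop :=
  let beta := x0 :: p in
  let n := size p in
  let x i := nth x0 beta i in
  path nadj x0 p /\
  ((forall v, (v \in beta /\ v \in A) <-> v = x 0%N) /\
   (forall v, (v \in beta /\ v \in B) <-> v = x n)) /\
  (~ is_corner (x 0%N) /\ ~ is_corner (x n)) /\
  (forall i, (1 <= i)%N -> (i + 1 <= n)%N -> x i \in F) /\
  (forall i, (2 <= i)%N -> (i + 2 <= n)%N ->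
     (1 < ndist_set (x i) (P3 :|: P4 :|: P1)%SET)%N) /\
  (forall v, v \in D ->
     [/\ (1 <= ndist (x 1%N) v)%N, (1 <= ndist (x n.-1) v)%N,
         ndist (x 1%N) v = 1%N -> v = x 0%N
       & ndist (x n.-1) v = 1%N -> v = x n]).

Definition vertically_thick : V -> seq V -> Prop :=
  thick_path P3 P1 (P1 :|: P3 :|: P4)%SET.

Definition horizontally_thick : V -> seq V -> Prop :=
  thick_path P2 P4 deltaF.

Definition shortest (thick : V -> seq V -> Prop) (rho : V -> R)
    (x0 : V) (p : seq V) : Prop :=
  thick x0 p /\
  forall y0 q, thick y0 q ->
    rho_length rho (x0 :: p) <= rho_length rho (y0 :: q).

End Network.

(* Main.v *)
Require Import Defs.
From mathcomp Require Import ring lra zify.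
Set Implicit Arguments.
Unset Strict Implicit.
Unset Printing Implicit Defensive.
Import Order.TTheory GRing.Theory Num.Theory.
Import numFieldNormedType.Exports.
Local Open Scope classical_set_scope.
Local Open Scope ring_scope.

(* Upper bound: rho(x)^2 <= 2 I(f), and a thick path can be shortened to at most
   |V| + 2 vertices.

   Lower bound: by Green's formula I(f) = g Phi, where Phi is the total normal
   derivative on P_4. A path from P_2 to P_4 has length at least m g, by
   telescoping. A path from P_3 to P_1 separates P_2 from P_4, so Phi is at most
   the flow through its vertices, which by Cauchy-Schwarz is at most M times its
   length.

   The separation is the statement that two curves in a closed disk joining
   interlaced pairs of boundary points meet. It follows from the
   Poincare-Miranda theorem in dimension two, proved by a parity count on a
   grid. Two edge paths of the triangulation can only meet in a common vertex,
   because a point of the realization has its support in the vertex set of every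
   edge path through it. *)

(** * Crossing curves in a disk *)

Definition nonconst_cell (h : nat -> nat -> bool) (i j : nat) : Prop :=
  (exists d e : bool, h (i + d)%N (j + e)%N) /\
  (exists d e : bool, ~~ h (i + d)%N (j + e)%N).

Lemma nonconst_cellP (h : nat -> nat -> bool) (i j : nat) :
  [|| h i j, h i.+1 j, h i j.+1 | h i.+1 j.+1] ->
  ~~ [&& h i j, h i.+1 j, h i j.+1 & h i.+1 j.+1] -> nonconst_cell h i j.
Proof.
move=> h1 h2; split; [move: h1|move: h2; rewrite !negb_and] => /or4P [] H.
- by exists false, false; rewrite !addn0.
- by exists true, false; rewrite addn0 addn1.
- by exists false, true; rewrite addn0 addn1.
- by exists true, true; rewrite !addn1.
- by exists false, false; rewrite !addn0.
- by exists true, false; rewrite addn0 addn1.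
- by exists false, true; rewrite addn0 addn1.
- by exists true, true; rewrite !addn1.
Qed.

(* Sperner-type parity count: call an edge marked if [a] holds at both ends and
   [b] changes along it. A cell with an odd number of marked edges is as
   wanted, and the boundary of the grid has an odd number of marked edges. *)
Lemma grid_nonconst_cell (n : nat) (a b : nat -> nat -> bool) :
  (forall j, (j <= n)%N -> a 0%N j = false) ->
  (forall j, (j <= n)%N -> a n j) ->
  (forall i, (i <= n)%N -> b i 0%N) ->
  (forall i, (i <= n)%N -> b i n = false) ->
  exists i j, [/\ (i < n)%N, (j < n)%N, nonconst_cell a i j & nonconst_cell b i j].
Proof.
move=> a0 an b0 bn; apply: contrapT => nex.
pose H i j := [&& a i j, a i.+1 j & b i j (+) b i.+1 j].
pose W i j := [&& a i j, a i j.+1 & b i j (+) b i j.+1].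
(* If [a] holds on a whole cell, [b] changes an even number of times around it; if [a] fails
   throughout or [b] is constant, no side is marked. So marked sides are odd in number only on a
   cell of the wanted kind. *)
have cell i j : (i < n)%N -> (j < n)%N ->
    W i.+1 j = W i j (+) (H i j (+) H i j.+1).
  move=> ltin ltjn; apply: contrapT => odd_cell; apply: nex; exists i, j.
  split=> //; apply: nonconst_cellP; move: odd_cell; rewrite /W /H;
  by case: (a i j); case: (a i.+1 j); case: (a i j.+1); case: (a i.+1 j.+1);
     case: (b i j); case: (b i.+1 j); case: (b i j.+1); case: (b i.+1 j.+1).
pose C i k := \big[addb/false]_(0 <= j < k) W i j.
have CS i k : (i < n)%N -> (k <= n)%N ->
    C i.+1 k = C i k (+) (H i 0%N (+) H i k).
  move=> ltin; elim: k => [|k IH] lekn.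
    by rewrite /C !big_geq //; case: (H i 0%N).
  rewrite /C !big_nat_recr //= -!/(C _ _) IH ?(ltnW lekn) // cell //.
  by case: (C i k) (W i k) (H i 0%N) (H i k) (H i k.+1) => [] [] [] [] [].
(* The left column has no marked edge since [a] fails there, and [b] is constant along the bottom
   and along the top, so even parity passes from column to column. *)
have Cn i : (i <= n)%N -> C i n = false.
  elim: i => [_|i IH ltin].
    by rewrite /C big_nat big1 // => j /andP [_ ltj]; rewrite /W a0 // ltnW.
  rewrite CS // (IH (ltnW ltin)) /H !b0 ?(ltnW ltin) // !bn ?(ltnW ltin) //.
  by rewrite !andbF.
(* In the last column [a] always holds, so the parity only records the changes of [b], which is true
   at the bottom and false at the top. *)
have tele k : (k <= n)%N -> C n k = ~~ b n k.
  elim: k => [|k IH] lekn; first by rewrite /C big_geq // b0.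
  rewrite /C big_nat_recr //= -/(C _ _) (IH (ltnW lekn)) /W !an ?(ltnW lekn) //.
  by case: (b n k) (b n k.+1) => [] [].
by have := tele n (leqnn n); rewrite Cn // bn.
Qed.

(** * The Poincare-Miranda theorem in the unit square *)

Section Planar.
Variable R : realType.

(** Were [h p] positive, [h] would be positive on a ball around [p], and this ball contains [v n]
    for some large [n] with [z n] close to [p]. With a cluster point of [z], several sequences [v]
    share the limit [p] without extraction of subsequences. *)
Lemma cluster_le0 (z v : nat -> R * R) (h : R * R -> R) (p : R * R) :
  continuous h -> cluster (z @ \oo) p ->
  (forall n, `|(z n).1 - (v n).1| <= n.+1%:R^-1 /\
             `|(z n).2 - (v n).2| <= n.+1%:R^-1) ->
  (forall n, h (v n) <= 0) -> h p <= 0.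
Proof.
move=> hc clp zv hv; rewrite leNgt; apply/negP => hp.
have : \forall q \near p, 0 < h q.
  exact: (cvgr_gt (h p) (hc p) _ hp).
move=> /nbhs_ballP [e /= e0 be].
have e20 : 0 < e / 2 by rewrite divr_gt0.
have ev : (z @ \oo) [set q | exists2 n, q = z n & n.+1%:R^-1 < e / 2].
  rewrite /fmap /=.
  have := near_infty_natSinv_lt (PosNum e20).
  apply: filterS => n /= ltn; exists n => //.
have nb : nbhs p (ball p (e / 2)) by apply: nbhsx_ballx.
have [q [[n -> ltn] [b1 b2]]] := clp _ _ ev nb.
have [v1 v2] := zv n.
have split_dist (a b c : R) : `|a - b| < e / 2 -> `|b - c| <= n.+1%:R^-1 ->
    `|a - c| < e.
  move=> ab bc; rewrite [e]splitr -(subrKA b).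
  exact: le_lt_trans (ler_normD _ _) (ltrD ab (le_lt_trans bc ltn)).
have : ball p e (v n).
  by split; [exact: split_dist b1 v1|exact: split_dist b2 v2].
by move/be; rewrite /= ltNge hv.
Qed.

(** On ever finer grids the parity count gives a cell on which neither function keeps a strict sign;
    such cells accumulate at a common zero. *)
Lemma poincare_miranda (u w : R * R -> R) :
  continuous u -> continuous w ->
  (forall t, 0 <= t <= 1 -> u (0, t) <= 0) ->
  (forall t, 0 <= t <= 1 -> 0 <= u (1, t)) ->
  (forall s, 0 <= s <= 1 -> 0 <= w (s, 0)) ->
  (forall s, 0 <= s <= 1 -> w (s, 1) <= 0) ->
  exists p : R * R, [/\ 0 <= p.1 <= 1, 0 <= p.2 <= 1, u p = 0 & w p = 0].
Proof.
move=> uc wc u0 u1 w0 w1.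
pose gp n i j : R * R := (i%:R / n.+1%:R, j%:R / n.+1%:R).
have gI (n i : nat) : (i <= n.+1)%N -> 0 <= (i%:R / n.+1%:R : R) <= 1.
  move=> le; apply/andP; split; first by rewrite divr_ge0.
  by rewrite ler_pdivrMr ?mul1r ?ler_nat ?ltr0n.
have near_corner (n i : nat) (d : bool) :
    `|i%:R / n.+1%:R - (i + d)%N%:R / n.+1%:R| <= n.+1%:R^-1 :> R.
  rewrite -mulrBl natrD opprD addrA subrr sub0r normrM normrN.
  rewrite [`|n.+1%:R^-1|]ger0_norm ?invr_ge0 //.
  by rewrite ler_piMl ?invr_ge0 //; case: d; rewrite ?normr1 ?normr0.
have nz (n : nat) : (n.+1%:R : R) != 0 by rewrite pnatr_eq0.
have cell n : exists z : R * R, [/\ 0 <= z.1 <= 1, 0 <= z.2 <= 1 &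
   exists v : 'I_4 -> R * R,
   [/\ forall k, `|z.1 - (v k).1| <= n.+1%:R^-1 /\
                 `|z.2 - (v k).2| <= n.+1%:R^-1,
       u (v 0) <= 0, 0 <= u (v 1), w (v 2) <= 0 & 0 <= w (v 3)]].
  (* Strict signs of [u] and [w], overridden on the sides of the square, where only weak
     inequalities are known. The overrides agree with these weak inequalities, and nothing more is
     read off from the cell. *)
  pose a i j := (i == n.+1) || ((i != 0)%N && (0 < u (gp n i j))).
  pose b i j := (j == 0)%N || ((j != n.+1) && (0 < w (gp n i j))).
  have [||||i [j [ltin ltjn]]] := @grid_nonconst_cell n.+1 a b.
  - by [].
  - by move=> j _; rewrite /a eqxx.
  - by [].
  - by move=> i _; rewrite /b eqxx.
  have lei (d : bool) : (i + d <= n.+1)%N.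
    by case: d; rewrite ?addn1 ?addn0 // ltnW.
  have lej (d : bool) : (j + d <= n.+1)%N.
    by case: d; rewrite ?addn1 ?addn0 // ltnW.
  case=> [[d1 [e1 a1]] [d0 [e0 a0]]] [[d3 [e3 b1]] [d2 [e2 b0]]].
  exists (gp n i j); split; [exact: gI (ltnW _)|exact: gI (ltnW _)|].
  exists (fun k => nth 0 [:: gp n (i + d0) (j + e0); gp n (i + d1) (j + e1);
                   gp n (i + d2) (j + e2); gp n (i + d3) (j + e3)]%N k).
  split.
  - by case; case=> [|[|[|[|//]]]] ?; split; apply: near_corner.
  - move: a0; rewrite /a negb_or negb_and negbK -leNgt => /andP [_] /=.
    case/orP => [/eqP ->|//]; rewrite /gp mul0r; exact/u0/gI.
  - move: a1; rewrite /a /= => /orP [/eqP -> |/andP [_ /ltW //]].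
    rewrite /gp divff //; exact/u1/gI.
  - move: b0; rewrite /b negb_or negb_and negbK -leNgt => /andP [_] /=.
    case/orP => [/eqP ->|//]; rewrite /gp divff //; exact/w1/gI.
  - move: b1; rewrite /b /= => /orP [/eqP -> |/andP [_ /ltW //]].
    rewrite /gp mul0r; exact/w0/gI.
have [z zP] := choice cell.
have /choice [v vP] : forall n, exists v : 'I_4 -> R * R,
   [/\ forall k, `|(z n).1 - (v k).1| <= n.+1%:R^-1 /\
                 `|(z n).2 - (v k).2| <= n.+1%:R^-1,
       u (v 0) <= 0, 0 <= u (v 1), w (v 2) <= 0 & 0 <= w (v 3)].
  by move=> n; case: (zP n).
have cpt : compact (`[0, 1]%classic `*` `[0, 1]%classic : set (R * R)).
  by apply: compact_setX; apply: segment_compact.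
have [|p [[/= p1 p2] clp]] := cpt (z @ \oo) _.
  exists 0%N => // n _ /=; have [] := zP n.
  by split=> /=; rewrite in_itv.
exists p; split.
- by move: p1; rewrite in_itv.
- by move: p2; rewrite in_itv.
- apply/eqP; rewrite eq_le; apply/andP; split.
    apply: (@cluster_le0 z (fun n => v n 0) u p uc clp) => n; last by case: (vP n).
    by case: (vP n) => /(_ 0).
  rewrite -oppr_le0.
  apply: (@cluster_le0 z (fun n => v n 1) (fun q => - u q) p _ clp) => [q|n|n].
  + by apply: cvgN; exact: uc.
  + by case: (vP n) => /(_ 1).
  + by rewrite oppr_le0; case: (vP n).
- apply/eqP; rewrite eq_le; apply/andP; split.
    apply: (@cluster_le0 z (fun n => v n 2) w p wc clp) => n; last by case: (vP n).
    by case: (vP n) => /(_ 2).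
  rewrite -oppr_le0.
  apply: (@cluster_le0 z (fun n => v n 3) (fun q => - w q) p _ clp) => [q|n|n].
  + by apply: cvgN; exact: wc.
  + by case: (vP n) => /(_ 3).
  + by rewrite oppr_le0; case: (vP n).
Qed.

End Planar.

(** * Crossing curves in an ellipse, and projective coordinates on the disk *)

Section Crossing.
Variable R : realType.

(* Adding a multiple of the second equation to the first, with coefficient
   depending on [s], makes the functional at [s = 0] and [s = 1] the polar form
   of the endpoint of the first curve, which has a sign on the ellipse. *)
Lemma ellipse_crossing (e : R) (x1 y1 x2 y2 : R -> R) : 0 < e ->
  continuous x1 -> continuous y1 -> continuous x2 -> continuous y2 ->
  (forall t, e * x2 t ^+ 2 + y2 t ^+ 2 <= 1) ->
  (forall s, -1 <= y1 s <= 1) ->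
  e * x1 0 ^+ 2 + y1 0 ^+ 2 = 1 -> x1 0 < 0 ->
  e * x1 1 ^+ 2 + y1 1 ^+ 2 = 1 -> 0 < x1 1 ->
  y2 0 = -1 -> y2 1 = 1 ->
  exists s t, [/\ 0 <= s <= 1, 0 <= t <= 1, x1 s = x2 t & y1 s = y2 t].
Proof.
move=> e0 cx1 cy1 cx2 cy2 in2 in1 a0 a0n a1 a1p b0 b1.
pose xi s := (1 - s) * (y1 0 / (e * x1 0)) + s * (y1 1 / (e * x1 1)).
pose w (p : R * R) := y1 p.1 - y2 p.2.
pose u (p : R * R) := x1 p.1 - x2 p.2 + xi p.1 * w p.
have c1 (h : R -> R) : continuous h -> continuous (fun p : R * R => h p.1).
  by move=> ch p; apply: continuous_comp; [exact: cvg_fst|exact: ch].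
have c2 (h : R -> R) : continuous h -> continuous (fun p : R * R => h p.2).
  by move=> ch p; apply: continuous_comp; [exact: cvg_snd|exact: ch].
have cw : continuous w.
  by move=> p; apply: cvgB; [exact: (c1 _ cy1)|exact: (c2 _ cy2)].
have cxi : continuous xi.
  move=> s; apply: cvgD; apply: cvgM; try exact: cvg_cst; try exact: cvg_id.
  by apply: cvgB; [exact: cvg_cst|exact: cvg_id].
have cu : continuous u.
  move=> p; apply: cvgD; last by apply: cvgM; [exact: (c1 _ cxi)|exact: cw].
  by apply: cvgB; [exact: (c1 _ cx1)|exact: (c2 _ cx2)].
(* The polar form of a point on the ellipse and a point inside is at most 1: expand
   [e * (x - x') ^+ 2 + (y - y') ^+ 2 >= 0]. *)
have polar (x y x' y' : R) : e * x ^+ 2 + y ^+ 2 = 1 -> x != 0 ->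
    e * x' ^+ 2 + y' ^+ 2 <= 1 ->
    0 <= x * (x - x' + y / (e * x) * (y - y')).
  move=> h x0 h'.
  have -> : x * (x - x' + y / (e * x) * (y - y')) =
            (e * x * (x - x') + y * (y - y')) / e.
    by field; rewrite x0 gt_eqF.
  apply: divr_ge0; last exact: ltW.
  have H1 : 0 <= e * (x - x') ^+ 2 by rewrite mulr_ge0 ?sqr_ge0 // ltW.
  have H2 := sqr_ge0 (y - y').
  lra.
have [||||[s t] [/= hs ht u0 w0]] := @poincare_miranda R u w cu cw.
- move=> t _; have := polar _ _ _ _ a0 (ltr0_neq0 a0n) (in2 t).
  by rewrite /u /w /xi /= subr0 mul1r mul0r addr0 nmulr_rge0.
- move=> t _; have := polar _ _ _ _ a1 (lt0r_neq0 a1p) (in2 t).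
  by rewrite /u /w /xi /= subrr mul1r mul0r add0r pmulr_rge0.
- by move=> s _; rewrite /w /= b0; have := in1 s; lra.
- by move=> s _; rewrite /w /= b1; have := in1 s; lra.
exists s, t; split=> //; last by apply/eqP; rewrite -subr_eq0; exact/eqP.
by apply/eqP; rewrite -subr_eq0; move: u0; rewrite /u w0 mulr0 addr0 => /eqP.
Qed.

(* [tan_base], [tan_at b] and [chord b] vanish on the tangents to the circle at
   [(1, 0)] and [b] and on the chord joining these points. The projective change
   of coordinates [(chord, tan_base - tan_at) / (tan_base + tan_at)] turns the
   circle into an ellipse with this chord as vertical axis. *)
Definition tan_base (z : R * R) : R := 1 - z.1.
Definition tan_at (b z : R * R) : R := 1 - b.1 * z.1 - b.2 * z.2.
Definition chord (b z : R * R) : R := (b.1 - 1) * z.2 - b.2 * (z.1 - 1).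
Definition tan_sum (b z : R * R) : R := tan_base z + tan_at b z.

(** For [b] other than [(1, 0)], the conics touching the circle at these two points form the pencil
    spanned by the pair of tangents and the doubled chord, and the circle is one of them. *)
Lemma conic_pencil (b z : R * R) : unit_circle b ->
  (2 - 2 * b.1) * tan_base z * tan_at b z - chord b z ^+ 2 =
  (1 - b.1) ^+ 2 * (1 - z.1 ^+ 2 - z.2 ^+ 2).
Proof.
rewrite /unit_circle /= => hb.
have -> : (1 - b.1) ^+ 2 * (1 - z.1 ^+ 2 - z.2 ^+ 2) =
  (1 - b.1) ^+ 2 * (1 - z.1 ^+ 2 - z.2 ^+ 2) -
   (b.1 ^+ 2 + b.2 ^+ 2 - 1) * (z.1 - 1) ^+ 2 by rewrite hb subrr mul0r subr0.
rewrite /tan_base /tan_at /chord; ring.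
Qed.

(** After division by [tan_sum b z], this relation recovers [tan_sum b z] from the first projective
    coordinate. It also prevents [tan_sum] and [chord] from vanishing together. *)
Lemma tan_sum_chord (b z : R * R) : unit_circle b ->
  (1 - b.1) * tan_sum b z - b.2 * chord b z = (1 - b.1) ^+ 2.
Proof.
rewrite /unit_circle /= => hb.
have -> : (1 - b.1) ^+ 2 =
  (1 - b.1) ^+ 2 + (b.1 ^+ 2 + b.2 ^+ 2 - 1) * (z.1 - 1).
  by rewrite hb subrr mul0r addr0.
rewrite /tan_sum /tan_base /tan_at /chord; ring.
Qed.

Lemma tan_at_ge0 (b z : R * R) : unit_circle b -> unit_disk z ->
  0 <= tan_at b z.
Proof.
rewrite /unit_circle /unit_disk /tan_at /= => hb hz.
have := sqr_ge0 (b.1 - z.1); have := sqr_ge0 (b.2 - z.2); nra.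
Qed.

Lemma unit_circle1 (b : R * R) : unit_circle b -> 1 <= b.1 -> b = (1, 0).
Proof.
case: b => x y; rewrite /unit_circle /= => h x1.
have y0 : y = 0 by apply/eqP; rewrite -sqrf_eq0 eq_le sqr_ge0 andbT; nra.
by congr pair => //; move: h; rewrite y0; nra.
Qed.

Lemma circle_fst_lt1 (b : R * R) : unit_circle b -> b != (1, 0) -> b.1 < 1.
Proof. by move=> hb; apply: contraNT; rewrite -leNgt => /(unit_circle1 hb) ->. Qed.

Lemma tan_base_ge0 (z : R * R) : unit_disk z -> 0 <= tan_base z.
Proof. rewrite /unit_disk /tan_base /= => hz; have := sqr_ge0 z.2; nra. Qed.

(** The line sent to infinity misses the disk: at a zero of the sum both tangent forms vanish, the
    pencil identity then kills [chord], and the linear relation is violated. *)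
Lemma tan_sum_gt0 (b z : R * R) : unit_circle b -> b != (1, 0) ->
  unit_disk z -> 0 < tan_sum b z.
Proof.
move=> hb b1 hz; have c1 := circle_fst_lt1 hb b1.
have t2 := tan_base_ge0 hz; have t4 := tan_at_ge0 hb hz.
rewrite lt_def addr_ge0 // andbT; apply/eqP => s0.
have t20 : tan_base z = 0 by move: s0; rewrite /tan_sum; lra.
have := tan_sum_chord z hb; rewrite s0 mulr0 sub0r => e1.
have := conic_pencil z hb; rewrite t20 mulr0 mul0r sub0r => e2.
have l0 : chord b z = 0.
  apply/eqP; rewrite -sqrf_eq0 eq_le sqr_ge0 andbT.
  have := hz; rewrite /unit_disk /= => h.
  have : 0 <= (1 - b.1) ^+ 2 * (1 - z.1 ^+ 2 - z.2 ^+ 2).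
    by rewrite mulr_ge0 ?sqr_ge0 //; lra.
  by rewrite -e2; lra.
move: e1; rewrite l0 mulr0 oppr0 => /esym/eqP; rewrite sqrf_eq0; lra.
Qed.

(** The first coordinate determines the common denominator by [tan_sum_chord]; then [tan_base] gives
    the abscissa and [chord] the ordinate. *)
Lemma tan_coordinates_inj (b z z' : R * R) : unit_circle b -> b != (1, 0) ->
  0 < tan_sum b z -> 0 < tan_sum b z' ->
  chord b z / tan_sum b z = chord b z' / tan_sum b z' ->
  (tan_base z - tan_at b z) / tan_sum b z =
  (tan_base z' - tan_at b z') / tan_sum b z' -> z = z'.
Proof.
move=> hb b1 s s' ex ey; have c1 := circle_fst_lt1 hb b1.
have e1 := tan_sum_chord z hb; have e2 := tan_sum_chord z' hb.
have D0 : (1 - b.1) ^+ 2 != 0 by rewrite sqrf_eq0; lra.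
have es : tan_sum b z = tan_sum b z'.
  have f1 : 1 - b.1 - b.2 * (chord b z / tan_sum b z) = (1 - b.1) ^+ 2 / tan_sum b z.
    by rewrite -e1; field; rewrite gt_eqF.
  have f2 : 1 - b.1 - b.2 * (chord b z' / tan_sum b z') = (1 - b.1) ^+ 2 / tan_sum b z'.
    by rewrite -e2; field; rewrite gt_eqF.
  by move: f1; rewrite ex f2 => /(mulfI D0) /invr_inj.
have sn : (tan_sum b z')^-1 != 0 by rewrite invr_eq0 gt_eqF.
move: ex ey; rewrite es => /(mulIf sn) el /(mulIf sn) et.
have et2 : tan_base z = tan_base z' by move: es et; rewrite /tan_sum; lra.
case: z z' et2 el {s s' e1 e2 es et sn} => [x y] [x' y'].
rewrite /tan_base /chord /= => e1 e2.
have exx : x = x' by lra.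
congr pair => //; move: e2; rewrite exx => /addIr.
by apply: mulfI; lra.
Qed.

Lemma disk_crossing_base (f h : R -> R * R) :
  continuous f -> continuous h ->
  (forall s, unit_disk (f s)) -> (forall t, unit_disk (h t)) ->
  unit_circle (f 0) -> unit_circle (f 1) ->
  h 0 = (1, 0) -> unit_circle (h 1) -> h 1 != (1, 0) ->
  chord (h 1) (f 0) < 0 -> 0 < chord (h 1) (f 1) ->
  exists s t, [/\ 0 <= s <= 1, 0 <= t <= 1 & f s = h t].
Proof.
move=> cf ch df dh f0 f1 h0 hb b1 l0 l1.
move bE: (h 1) hb b1 l0 l1 => b hb b1 l0 l1.
have c1 := circle_fst_lt1 hb b1.
have sp z : unit_disk z -> 0 < tan_sum b z by apply: tan_sum_gt0.
pose X z := chord b z / tan_sum b z.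
pose Y z := (tan_base z - tan_at b z) / tan_sum b z.
have c1f (k : R -> R * R) : continuous k -> continuous (fun s => (k s).1).
  by move=> ck s; apply: continuous_comp; [exact: ck|exact: cvg_fst].
have c2f (k : R -> R * R) : continuous k -> continuous (fun s => (k s).2).
  by move=> ck s; apply: continuous_comp; [exact: ck|exact: cvg_snd].
have caff (k : R -> R * R) p q r : continuous k ->
   continuous (fun s => p + q * (k s).1 + r * (k s).2).
  move=> ck s; apply: cvgD; last by
    apply: cvgM; [exact: cvg_cst|exact: (c2f _ ck)].
  apply: cvgD; first exact: cvg_cst.
  by apply: cvgM; [exact: cvg_cst|exact: (c1f _ ck)].
have csig (k : R -> R * R) : continuous k -> continuous (fun s => tan_sum b (k s)).
  move=> ck; have -> : (fun s => tan_sum b (k s)) =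
      (fun s => 2 + (- 1 - b.1) * (k s).1 + (- b.2) * (k s).2).
    by apply/funext => s; rewrite /tan_sum /tan_base /tan_at; ring.
  exact: caff.
have cX (k : R -> R * R) : continuous k -> (forall s, unit_disk (k s)) ->
    continuous (X \o k).
  move=> ck dk s; apply: cvgM; last first.
    by apply: cvgV; [rewrite gt_eqF // sp|exact: csig].
  have E : (fun s => chord b (k s)) =
           (fun s => b.2 + (- b.2) * (k s).1 + (b.1 - 1) * (k s).2).
    by apply/funext => r; rewrite /chord /=; ring.
  by have := caff _ b.2 (- b.2) (b.1 - 1) ck s; rewrite -E.
have cY (k : R -> R * R) : continuous k -> (forall s, unit_disk (k s)) ->
    continuous (Y \o k).
  move=> ck dk s; apply: cvgM; last first.
    by apply: cvgV; [rewrite gt_eqF // sp|exact: csig].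
  have E : (fun s => tan_base (k s) - tan_at b (k s)) =
           (fun s => 0 + (b.1 - 1) * (k s).1 + b.2 * (k s).2).
    by apply/funext => r; rewrite /tan_base /tan_at /=; ring.
  by have := caff _ 0 (b.1 - 1) b.2 ck s; rewrite -E.
have c1n : 1 - b.1 != 0 by rewrite subr_eq0 gt_eqF.
(* On the circle this factor turns the squared chord form into four times the product of the tangent
   forms, which completes the square of their difference to the square of their sum. *)
pose e : R := 2 / (1 - b.1).
have e0 : 0 < e by rewrite divr_gt0 // subr_gt0.
have ell z : unit_disk z -> e * X z ^+ 2 + Y z ^+ 2 =
    1 - 2 * (1 - b.1) * (1 - z.1 ^+ 2 - z.2 ^+ 2) / tan_sum b z ^+ 2.
  move=> hz; have s0 := sp _ hz; have := conic_pencil z hb => E.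
  have -> : 2 * (1 - b.1) * (1 - z.1 ^+ 2 - z.2 ^+ 2) =
     2 / (1 - b.1) * ((1 - b.1) ^+ 2 * (1 - z.1 ^+ 2 - z.2 ^+ 2)).
    by field.
  rewrite -E /X /Y /e.
  by move: s0; rewrite /tan_sum => s0; field; rewrite gt_eqF.
have ellc z : unit_circle z -> e * X z ^+ 2 + Y z ^+ 2 = 1.
  move=> hz; rewrite ell; last by rewrite /unit_disk /= hz.
  rewrite (_ : 1 - z.1 ^+ 2 - z.2 ^+ 2 = 0) ?mulr0 ?mul0r ?subr0 //.
  by move: hz; rewrite /unit_circle /=; lra.
have elld z : unit_disk z -> e * X z ^+ 2 + Y z ^+ 2 <= 1.
  move=> hz; rewrite ell // gerBl divr_ge0 ?sqr_ge0 //.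
  rewrite mulr_ge0 //; first by lra.
  by move: hz; rewrite /unit_disk /=; lra.
have [||||||||s [t [hs ht ex ey]]] := @ellipse_crossing e (X \o f) (Y \o f)
  (X \o h) (Y \o h) e0 (cX _ cf df) (cY _ cf df) (cX _ ch dh) (cY _ ch dh).
- by move=> t; exact: elld.
- move=> s; rewrite /Y /=; have s0 := sp _ (df s).
  have t2 := tan_base_ge0 (df s); have t4 := tan_at_ge0 hb (df s).
  by rewrite ler_pdivlMr // ler_pdivrMr // /tan_sum; lra.
- exact: ellc.
- by rewrite /X /= pmulr_llt0 // invr_gt0 sp.
- exact: ellc.
- by rewrite /X /= divr_gt0 // sp.
- have := sp _ (dh 0); rewrite /Y /= h0 /tan_sum /tan_base /= subrr sub0r add0r => q.
  by rewrite mulNr divff // gt_eqF.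
- have := sp _ (dh 1); rewrite /Y /= bE /tan_sum.
  have -> : tan_at b b = 0.
    by move: hb; rewrite /unit_circle /tan_at /= !expr2; lra.
  by rewrite subr0 addr0 => q; rewrite divff // gt_eqF.
exists s, t; split => //.
by apply: (tan_coordinates_inj hb b1) => //; apply: sp.
Qed.

End Crossing.

(** * Order along the circle and the two sides of a chord *)

Section Circle.
Variable R : realType.

Lemma pos_of_nonzero (G : R -> R) (a t : R) : continuous G -> 0 < G a ->
  (forall c, Num.min a t <= c <= Num.max a t -> G c != 0) -> 0 < G t.
Proof.
move=> cG Ga nz; rewrite ltNge; apply/negP => Gt.
have cw (x y : R) : {within `[x, y], continuous G}.
  exact: continuous_subspaceT.
have [le|/ltW le] := leP a t; [have := @IVT R G a t 0 le (cw _ _)|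
                               have := @IVT R G t a 0 le (cw _ _)].
  case=> [|c /[!in_itv]/= cI c0].
    by rewrite ge_min le_max Gt orbT (ltW Ga).
  by have := nz c; rewrite c0 eqxx (min_l le) (max_r le) cI => /(_ isT).
case=> [|c /[!in_itv]/= cI c0].
  by rewrite ge_min le_max Gt /= (ltW Ga) orbT.
by have := nz c; rewrite c0 eqxx (min_r le) (max_l le) cI => /(_ isT).
Qed.

(** By the pencil identity one of the tangent forms vanishes at [z], and a tangent meets the circle
    only at its point of contact. *)
Lemma chord_eq0 (b z : R * R) : unit_circle b -> b != (1, 0) ->
  unit_circle z -> chord b z = 0 -> z = (1, 0) \/ z = b.
Proof.
move=> hb b1 hz l0; have c1 := circle_fst_lt1 hb b1.
have := conic_pencil z hb; rewrite l0 expr0n /= subr0.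
have -> : 1 - z.1 ^+ 2 - z.2 ^+ 2 = 0 by move: hz; rewrite /unit_circle /=; lra.
rewrite mulr0 => /eqP; rewrite !mulf_eq0 => /orP [/orP [|]|] /eqP h.
- by exfalso; lra.
- by left; apply: unit_circle1 => //; move: h; rewrite /tan_base; lra.
- right; move: h hz hb {l0 b1 c1}; rewrite /tan_at /unit_circle.
  case: z b => [x y] [p q] /= h hz hb.
  have xp : (x - p) ^+ 2 + (y - q) ^+ 2 = 0 by rewrite !expr2 in hz hb *; lra.
  move: xp => /eqP; rewrite paddr_eq0 ?sqr_ge0 // !sqrf_eq0 !subr_eq0.
  by case/andP => /eqP -> /eqP ->.
Qed.

Lemma circle_other_side (b : R * R) (k : R) : unit_circle b -> b != (1, 0) ->
  k != 0 -> exists2 z, unit_circle z & chord b z * k < 0.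
Proof.
move=> hb b1 k0; have c1 := circle_fst_lt1 hb b1.
(* [D] is the squared length of the chord. The witnesses are the two unit vectors orthogonal to it,
   where the form takes the values [r + b.2] and [- r + b.2], and [b.2] is smaller than [r] in
   absolute value. *)
pose D := 2 - 2 * b.1; have D0 : 0 < D by rewrite /D; lra.
pose r := Num.sqrt D; have r0 : 0 < r by rewrite sqrtr_gt0.
have r2 : r ^+ 2 = D by rewrite sqr_sqrtr // ltW.
have rn : r != 0 by rewrite gt_eqF.
move: hb; rewrite {1}/unit_circle /= => hb.
have lt_r (y : R) : y ^+ 2 = b.2 ^+ 2 -> y < r.
  move=> hy; have [y0|y0] := leP y 0; first exact: le_lt_trans r0.
  rewrite -(ltr_pXn2r (n := 2)) ?nnegrE ?(ltW y0) ?(ltW r0) // hy r2 /D.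
  have : 0 < (1 - b.1) ^+ 2 by rewrite exprn_gt0 // subr_gt0.
  by move: hb; rewrite !expr2; lra.
have circ (e : R) : e ^+ 2 = 1 -> unit_circle (- e * b.2 / r, e * (b.1 - 1) / r).
  move=> e2; rewrite /unit_circle /= !expr_div_n r2 -mulrDl !exprMn sqrrN e2.
  rewrite !mul1r (_ : b.2 ^+ 2 + (b.1 - 1) ^+ 2 = D) ?divff ?gt_eqF //.
  by rewrite /D; move: hb; rewrite !expr2; lra.
have val (e : R) : e ^+ 2 = 1 -> chord b (- e * b.2 / r, e * (b.1 - 1) / r) = e * r + b.2.
  move=> e2; rewrite /chord /=.
  have -> : (b.1 - 1) * (e * (b.1 - 1) / r) - b.2 * (- e * b.2 / r - 1) =
     e * ((b.1 - 1) ^+ 2 + b.2 ^+ 2) / r + b.2 by field.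
  congr (_ + _); have -> : (b.1 - 1) ^+ 2 + b.2 ^+ 2 = r ^+ 2.
    by rewrite r2 /D; move: hb; rewrite !expr2; lra.
  by field.
have [kp|kn] := ltrP 0 k.
  exists (- -1 * b.2 / r, -1 * (b.1 - 1) / r); first by apply: circ; rewrite sqrrN expr1n.
  rewrite val ?sqrrN ?expr1n // pmulr_llt0 //.
  by have := lt_r b.2 erefl; lra.
exists (- 1 * b.2 / r, 1 * (b.1 - 1) / r); first by apply: circ; rewrite expr1n.
have kn0 : k < 0 by rewrite lt_neqAle k0.
rewrite val ?expr1n // nmulr_llt0 //.
by have := lt_r (- b.2) (sqrrN _); lra.
Qed.

(** Continuity on the whole line avoids subspace topologies; the boundary of the quadrilateral
    qualifies once its parameter is clamped to [[0, 4]]. *)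
Definition circle_loop (b : R -> R * R) : Prop :=
  [/\ continuous b, forall t, unit_circle (b t),
      forall s t, 0 <= s < 4 -> 0 <= t < 4 -> b s = b t -> s = t,
      b 0 = b 4 & forall z, unit_circle z -> exists2 t, 0 <= t <= 4 & b t = z].

(** The chord form vanishes on the loop only at the endpoints of the chord. If [b t1] and [b t3]
    were on the same side, the form would keep one weak sign on the whole circle, contradicting
    [circle_other_side]. *)
Lemma circle_alternation (b : R -> R * R) (t1 t2 t3 t4 : R) :
  circle_loop b -> 0 <= t1 -> t1 < t2 -> t2 < t3 -> t3 < t4 -> t4 <= 4 ->
  b t1 != b t4 -> b t2 = (1, 0) ->
  b t4 != (1, 0) /\ chord (b t4) (b t1) * chord (b t4) (b t3) < 0.
Proof.
move=> [cb bc binj b04 bsurj] t10 t12 t23 t34 t44 b14 bt2.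
have inj s t : 0 <= s <= 4 -> 0 <= t <= 4 -> b s = b t ->
    s = t \/ (s = 0 /\ t = 4) \/ (s = 4 /\ t = 0).
  move=> hs ht e; have [s4|s4] := ltrP s 4; have [t4'|t4'] := ltrP t 4.
  - by left; apply: binj => //; apply/andP; split=> //; case/andP: hs ht => ? ? /andP [].
  - have t4e : t = 4 by lra.
    rewrite t4e in e *; right; left; split=> //; apply: binj; [lra|lra|].
    by rewrite b04.
  - have s4e : s = 4 by lra.
    rewrite s4e in e *; right; right; split=> //; apply: binj; [lra|lra|].
    by rewrite b04.
  - by left; lra.
have B1 : b t4 != (1, 0).
  by apply/eqP => h; have [] := inj t2 t4; rewrite ?bt2 ?h //; lra.
split=> //; set B := b t4 in b14 B1 *.
have hB : unit_circle B by exact: bc.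
(* The parameters 0 and 4 give the same point, so [t = 0] is a further zero when [t4 = 4]. *)
have zeros t : 0 <= t <= 4 -> chord B (b t) = 0 ->
    [\/ t = t2, t = t4 | t4 = 4 /\ t = 0].
  move=> ht /(chord_eq0 hB B1 (bc t)) [h|h].
    have [] := inj t t2; rewrite ?bt2 ?h //; first by lra.
      by constructor 1.
    by lra.
  have [] := inj t t4 ht _ h; first by lra.
    by constructor 2.
  by case=> [[-> ->]|]; [constructor 3|lra].
have L1 : chord B (b t1) != 0.
  apply/eqP => h; case: (zeros t1 _ h); [lra|lra|lra|case=> e1 e2].
  by move: b14; rewrite e2 /B e1 b04 eqxx.
have L3 : chord B (b t3) != 0.
  by apply/eqP => h; case: (zeros t3 _ h); [lra|lra|lra|case=> _; lra].
rewrite ltNge; apply/negP => pos.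
set k := chord B (b t3) in L3 pos *.
pose G t := chord B (b t) * k.
have cG : continuous G.
  move=> t; apply: cvgM; last exact: cvg_cst.
  have c1 : (b s).1 @[s --> t] --> (b t).1.
    by apply: continuous_comp; [exact: cb|exact: cvg_fst].
  have c2 : (b s).2 @[s --> t] --> (b t).2.
    by apply: continuous_comp; [exact: cb|exact: cvg_snd].
  apply: cvgB; apply: cvgM; try exact: cvg_cst; first exact: c2.
  by apply: cvgB; [exact: c1|exact: cvg_cst].
have Gz t : 0 <= t <= 4 -> G t = 0 -> [\/ t = t2, t = t4 | t4 = 4 /\ t = 0].
  by move=> ht /eqP; rewrite mulf_eq0 (negbTE L3) orbF => /eqP; apply: zeros.
have G1 : 0 < G t1 by rewrite lt_def mulf_neq0.
have G3 : 0 < G t3 by rewrite lt_def mulf_neq0 //= /G -/k -expr2 sqr_ge0.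
have G0 : t4 < 4 -> 0 < G 0.
  move=> lt4; apply: (pos_of_nonzero cG G1) => c; rewrite (min_r t10) (max_l t10).
  by move=> hc; apply/eqP => h; case: (Gz c _ h); [lra|lra|lra|case; lra].
(* The sign is carried over from [t1] before [t2], from [t3] between [t2] and [t4], and from 4 after
   [t4], where the loop has returned to its value at 0. *)
have Gpos t : 0 <= t <= 4 -> 0 <= G t.
  move=> ht; have [lt|le] := ltrP t t2.
    have [/andP [/eqP t0 /eqP e4]|] := boolP ((t == 0) && (t4 == 4)).
      by rewrite t0 /G b04 -e4 -/B (_ : chord B B = 0) ?mul0r // /chord; ring.
    rewrite negb_and => /orP h0.
    apply/ltW/(pos_of_nonzero cG G1) => c hc; apply/eqP => h.
    have hc2 : c < t2.
      by case/andP: hc => _; rewrite le_max => /orP [] ?; lra.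
    have hc0 : 0 <= c.
      by case/andP: hc; rewrite ge_min => /orP [] ?; lra.
    case: (Gz c _ h); [lra|lra|lra|case=> e4 c0].
    case: h0 => [t0|]; last by rewrite e4 eqxx.
    have tp : 0 < t by rewrite lt_def t0; lra.
    have t1p : 0 < t1.
      by rewrite lt_def t10 andbT; apply/eqP => e; move: b14; rewrite e b04 -e4 eqxx.
    by case/andP: hc; rewrite ge_min => /orP [] ?; lra.
  have [le4|lt4] := lerP t t4; last first.
    have lt44 : t4 < 4 by lra.
    have G4 : 0 < G 4 by rewrite /G -b04; exact: G0.
    have t4' : t <= 4 by lra.
    apply/ltW/(pos_of_nonzero cG G4) => c; rewrite (min_r t4') (max_l t4') => hc.
    by apply/eqP => h; case: (Gz c _ h); [lra|lra|lra|case; lra].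
  have [->|nt2] := eqVneq t t2.
    by rewrite /G bt2 (_ : chord B (1, 0) = 0) ?mul0r // /chord /=; ring.
  have [->|nt4] := eqVneq t t4.
    by rewrite /G -/B (_ : chord B B = 0) ?mul0r // /chord; ring.
  have lt2 : t2 < t by rewrite lt_neqAle eq_sym nt2.
  have lt4 : t < t4 by rewrite lt_neqAle nt4.
  apply/ltW/(pos_of_nonzero cG G3) => c hc; apply/eqP => h.
  have hc2 : t2 < c by case/andP: hc; rewrite ge_min => /orP [] ?; lra.
  have hc4 : c < t4 by case/andP: hc => _; rewrite le_max => /orP [] ?; lra.
  by case: (Gz c _ h); [lra|lra|lra|case=> _; lra].
have [z hz] := circle_other_side hB B1 L3.
by have [t ht <-] := bsurj z hz; rewrite ltNge Gpos.
Qed.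

Lemma disk_crossing (b f h : R -> R * R) (t1 t2 t3 t4 : R) :
  circle_loop b -> 0 <= t1 -> t1 < t2 -> t2 < t3 -> t3 < t4 -> t4 <= 4 ->
  b t1 != b t4 ->
  continuous f -> continuous h ->
  (forall s, unit_disk (f s)) -> (forall t, unit_disk (h t)) ->
  f 0 = b t3 -> f 1 = b t1 -> h 0 = b t2 -> h 1 = b t4 ->
  exists s t, [/\ 0 <= s <= 1, 0 <= t <= 1 & f s = h t].
Proof.
move=> [cb bc binj b04 bsurj] t10 t12 t23 t34 t44 b14 cf ch df dh f0 f1 h0 h1.
move pqE: (b t2) (bc t2) => [p q] pq.
have {}pq : p ^+ 2 + q ^+ 2 = 1 by [].
(* The rotation taking [b t2] to [(1, 0)]. *)
pose rot (z : R * R) := (p * z.1 + q * z.2, p * z.2 - q * z.1).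
have rotN z : (rot z).1 ^+ 2 + (rot z).2 ^+ 2 = z.1 ^+ 2 + z.2 ^+ 2.
  by rewrite -[RHS]mul1r -pq /rot /=; ring.
have rotK : cancel rot (fun z => (p * z.1 - q * z.2, p * z.2 + q * z.1)).
  move=> [x y]; rewrite /rot /=; congr pair.
    by rewrite -[RHS]mul1r -pq; ring.
  by rewrite -[RHS]mul1r -pq; ring.
have rotD z : unit_disk z -> unit_disk (rot z).
  by rewrite /unit_disk /mkset rotN.
have rotC z : unit_circle z -> unit_circle (rot z).
  by rewrite /unit_circle /mkset rotN.
have crot (k : R -> R * R) : continuous k -> continuous (rot \o k).
  move=> ck s.
  have c1 : (k r).1 @[r --> s] --> (k s).1.
    by apply: continuous_comp; [exact: ck|exact: cvg_fst].
  have c2 : (k r).2 @[r --> s] --> (k s).2.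
    by apply: continuous_comp; [exact: ck|exact: cvg_snd].
  have d1 : p * (k r).1 + q * (k r).2 @[r --> s] --> p * (k s).1 + q * (k s).2.
    by apply: cvgD; apply: cvgM => //; exact: cvg_cst.
  have d2 : p * (k r).2 - q * (k r).1 @[r --> s] --> p * (k s).2 - q * (k s).1.
    by apply: cvgB; apply: cvgM => //; exact: cvg_cst.
  exact: (cvg_pair d1 d2).
have loop : circle_loop (rot \o b).
  split=> //=; first exact: crot.
  - by move=> t; apply: rotC.
  - by move=> s t hs ht /(can_inj rotK); apply: binj.
  - by rewrite b04.
  - move=> z hz; pose z' := (p * z.1 - q * z.2, p * z.2 + q * z.1).
    have ez : rot z' = z.
      case: (z) @z' => [x y]; rewrite /rot /=; congr pair.
        by rewrite -[RHS]mul1r -pq; ring.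
      by rewrite -[RHS]mul1r -pq; ring.
    have [|t ht e] := bsurj z'; first by rewrite /unit_circle /mkset -rotN ez.
    by exists t; rewrite //= e.
have rb2 : (rot \o b) t2 = (1, 0).
  by rewrite /= pqE /rot /=; congr pair; [rewrite -pq|]; ring.
have b14' : (rot \o b) t1 != (rot \o b) t4 by rewrite /= (can_eq rotK).
have [B1] := circle_alternation loop t10 t12 t23 t34 t44 b14' rb2.
rewrite /= -f0 -f1 -h1 => alt.
have fd s : unit_disk ((rot \o f) s) by exact/rotD.
have hd s : unit_disk ((rot \o h) s) by exact/rotD.
have rh0 : (rot \o h) 0 = (1, 0) by rewrite /= h0.
have rh1 : unit_circle ((rot \o h) 1) by rewrite /= h1; exact/rotC.
have rh1n : (rot \o h) 1 != (1, 0) by rewrite /= h1.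
have rf0 : unit_circle ((rot \o f) 0) by rewrite /= f0; exact/rotC.
have rf1 : unit_circle ((rot \o f) 1) by rewrite /= f1; exact/rotC.
have [l0|l0] := ltrP (chord (rot (h 1)) (rot (f 0))) 0.
  have [|s [t [hs ht e]]] := @disk_crossing_base R _ _ (crot _ cf) (crot _ ch)
    fd hd rf0 rf1 rh0 rh1 rh1n l0; first by move: alt; rewrite nmulr_llt0.
  by exists s, t; split=> //; apply: (can_inj rotK).
(* The orientation of the loop is unknown, so [f] may start on the positive side of the chord; it is
   then run backwards. *)
pose f' s := f (1 - s).
have cf' : continuous f'.
  move=> s; have c1 : 1 - r @[r --> s] --> 1 - s.
    by apply: cvgB; [exact: cvg_cst|exact: cvg_id].
  exact: cvg_comp c1 (cf (1 - s)).
have fd' s : unit_disk ((rot \o f') s) by apply: rotD; apply: df.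
have e0 : f' 0 = f 1 by rewrite /f' subr0.
have e1 : f' 1 = f 0 by rewrite /f' subrr.
have rf0' : unit_circle ((rot \o f') 0) by rewrite /comp e0.
have rf1' : unit_circle ((rot \o f') 1) by rewrite /comp e1.
have l1' : chord (rot (h 1)) (rot (f 1)) < 0.
  by rewrite ltNge; apply/negP => l1; move: alt; rewrite ltNge mulr_ge0.
have l0' : 0 < chord (rot (h 1)) (rot (f 0)).
  by rewrite lt_def l0 andbT; apply/eqP => e; move: alt; rewrite e mulr0 ltxx.
have [||s [t [hs ht e]]] := @disk_crossing_base R _ _ (crot _ cf') (crot _ ch)
    fd' hd rf0' rf1' rh0 rh1 rh1n.
- by rewrite /= e0.
- by rewrite /= e1.
exists (1 - s), t; split=> //; first by lra.
exact: (can_inj rotK).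
Qed.

End Circle.

(** * Crossing edge paths in a triangulated quadrilateral *)

Section Curves.
Variable R : realType.

Lemma ptws_continuous (X : topologicalType) (V : Type) (W : X -> {ptws V -> R}) :
  (forall v, continuous (fun s => W s v)) -> continuous W.
Proof.
move=> cW s; apply/cvg_sup => v A /= [_ [[B Bop <-] Bs sBA]].
rewrite nbhs_filterE; apply: filterS sBA _.
by apply: (cW v s); apply: open_nbhs_nbhs.
Qed.

Lemma continuous_comp_within (X Y Z : topologicalType) (A : set Y) (f : X -> Y)
    (h : Y -> Z) : continuous f -> (forall x, A (f x)) ->
  {within A, continuous h} -> continuous (h \o f).
Proof.
move=> cf fA /subspace_continuousP ch x.
apply: cvg_comp (ch _ (fA x)) => B.
rewrite /within /= => nB; move: (cf x _ nB).
by apply: (@filterS _ (nbhs x)) => y; apply.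
Qed.

(** For [n >= 0], the projection of the line onto [[0, n]]; it extends curves given on an interval
    to the whole line. *)
Definition clamp (n x : R) : R := Num.max 0 (Num.min n x).

Lemma clamp_continuous (n : R) : continuous (clamp n).
Proof.
move=> x; apply: (@continuous_max R R (fun=> 0) (fun y => Num.min n y)).
  exact: cvg_cst.
apply: (@continuous_min R R (fun=> n) id); [exact: cvg_cst|exact: cvg_id].
Qed.

Lemma clamp_itv (n x : R) : 0 <= n -> 0 <= clamp n x <= n.
Proof. by move=> n0; rewrite /clamp le_max lexx ge_max n0 ge_min lexx. Qed.

Lemma clamp_id (n x : R) : 0 <= x <= n -> clamp n x = x.
Proof. by move=> /andP [x0 xn]; rewrite /clamp (min_r xn) (max_r x0). Qed.

(** Integer translates of this function interpolate linearly between successive vertices, in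
    barycentric coordinates. *)
Definition hat (x : R) : R := Num.max 0 (1 - `|x|).

Lemma hat_continuous : continuous hat.
Proof.
move=> x; apply: (@continuous_max R R (fun=> 0) (fun y => 1 - `|y|)).
  exact: cvg_cst.
by apply: cvgB; [exact: cvg_cst|exact: norm_continuous].
Qed.

Lemma hat_ge0 (x : R) : 0 <= hat x.
Proof. by rewrite /hat le_max lexx. Qed.

Lemma hat_eq0 (x : R) : 1 <= `|x| -> hat x = 0.
Proof. by move=> h; rewrite /hat max_l // subr_le0. Qed.

Section EdgePath.
Variables (V : finType) (adj : rel V) (tris : {set {set V}}).
Hypothesis adj_irr : irreflexive adj.
Variables (x0 : V) (p : seq V).

(* At [x_i] at time [i], and affine in between. *)
Definition edge_curve (s : R) : {ptws V -> R} :=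
  fun v => \sum_(i < (size p).+1) hat (s - i%:R) * (nth x0 (x0 :: p) i == v)%:R.

Lemma edge_curve_continuous : continuous edge_curve.
Proof.
apply: ptws_continuous => v; apply: continuous_big => [|i _ s].
  exact: add_continuous.
apply: cvgM; last exact: cvg_cst.
have c1 : r - i%:R @[r --> s] --> s - i%:R.
  by apply: cvgB; [exact: cvg_id|exact: cvg_cst].
exact: cvg_comp c1 (@hat_continuous _).
Qed.

Lemma edge_curve_segment (s : R) : (0 < size p)%N -> 0 <= s <= (size p)%:R ->
  exists i r, [/\ (i < size p)%N, 0 <= r <= 1, s = i%:R + r &
    forall v, edge_curve s v = (1 - r) * (nth x0 (x0 :: p) i == v)%:R +
                               r * (nth x0 (x0 :: p) i.+1 == v)%:R].
Proof.
move=> n0 /andP [s0 sn].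
have [i [lti /andP [is1 is2]]] : exists i, (i < size p)%N /\ i%:R <= s <= i.+1%:R.
  have /andP [t1 t2] := truncn_itv s0.
  have [lt|le] := ltnP (Num.truncn s) (size p).
    by exists (Num.truncn s); rewrite lt t1 ltW.
  (* At the right end the integer part of [s] is no longer the index of a segment, so the last
     segment is taken. *)
  exists (size p).-1; rewrite prednK // leqnn; split=> //; rewrite sn andbT.
  by apply: le_trans t1; rewrite ler_nat; exact: leq_trans (leq_pred _) le.
exists i, (s - i%:R); rewrite -[i.+1]addn1 natrD in is2.
split=> [//||//|v]; [lra|lra|].
rewrite /edge_curve (bigD1 (inord i)) //= (bigD1 (inord i.+1)) /=; last first.
  by rewrite -val_eqE /= !inordK ?ltnS ?(ltnW lti) // gtn_eqF.
rewrite !inordK ?ltnS ?(ltnW lti) // big1 ?addr0; last first.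
  move=> j /andP []; rewrite -!val_eqE /= !inordK ?ltnS ?(ltnW lti) // => ji ji1.
  rewrite hat_eq0 ?mul0r //.
  have [lt|le] := ltnP j i.
    have : (j + 1)%N%:R <= i%:R :> R by rewrite ler_nat addn1.
    by rewrite natrD => h; rewrite ger0_norm; lra.
  have : (i + 2)%N%:R <= j%:R :> R.
    by rewrite ler_nat addn2 ltn_neqAle eq_sym ji1 ltn_neqAle eq_sym ji.
  by rewrite natrD => h; rewrite ler0_norm; lra.
congr (_ * _ + _ * _).
  by rewrite /hat ger0_norm ?max_r; lra.
by rewrite -[i.+1]addn1 natrD /hat ler0_norm ?max_r; lra.
Qed.

Lemma edge_curve_vertex (i : nat) : (i <= size p)%N ->
  edge_curve i%:R = vertex_point R (nth x0 (x0 :: p) i).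
Proof.
move=> le; apply/funext => v.
rewrite /edge_curve (bigD1 (inord i)) //= inordK ?ltnS // big1 => [|j].
  by rewrite addr0 subrr /hat normr0 subr0 max_r // mul1r /vertex_point eq_sym.
rewrite -val_eqE /= inordK ?ltnS // => ji; rewrite hat_eq0 ?mul0r //.
have [lt|] := ltnP j i.
  have : (j + 1)%N%:R <= i%:R :> R by rewrite ler_nat addn1.
  by rewrite natrD => h; rewrite ger0_norm; lra.
rewrite leq_eqVlt eq_sym (negbTE ji) /= => lt.
have : (i + 1)%N%:R <= j%:R :> R by rewrite ler_nat addn1.
by rewrite natrD => h; rewrite ler0_norm; lra.
Qed.

Lemma edge_curve_supp (s : R) (v : V) : edge_curve s v != 0 -> v \in x0 :: p.
Proof.
apply: contraNT => vp; rewrite /edge_curve big1 // => i _.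
have [e|_] := eqVneq; last by rewrite mulr0.
by move: vp; rewrite -e mem_nth //= .
Qed.

(** On each segment the support is one endpoint or the whole edge; irreflexivity keeps the endpoints
    distinct, so their weights do not merge. *)
Lemma edge_curve_realization (s : R) : path adj x0 p -> (0 < size p)%N ->
  0 <= s <= (size p)%:R -> realization adj tris (edge_curve s).
Proof.
move=> pth n0 hs; have [i [r [lti hr _ E]]] := edge_curve_segment n0 hs.
set x := nth x0 (x0 :: p) i in E; set y := nth x0 (x0 :: p) i.+1 in E.
have xy : adj x y by exact: (pathP x0 pth).
have nxy : x != y by apply: contraTneq xy => ->; rewrite adj_irr.
split.
- by move=> v; rewrite sumr_ge0 // => j _; rewrite mulr_ge0 // hat_ge0.
- under eq_bigr do rewrite E.
  rewrite big_split /= -!mulr_sumr.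
  have one (z : V) : \sum_v ((z == v)%:R : R) = 1.
    rewrite (bigD1 z) //= eqxx big1 ?addr0 // => v.
    by rewrite eq_sym => /negbTE ->.
  by rewrite !one; lra.
have suppE v : (v \in supp (edge_curve s)) =
    ((v == x) && (r != 1)) || ((v == y) && (r != 0)).
  rewrite inE E ![_ == v]eq_sym.
  have [->|vx] := eqVneq v x.
    by rewrite (negbTE nxy) /= mulr0 addr0 mulr1 orbF subr_eq0 eq_sym.
  by rewrite /= mulr0 add0r; case: (v == y); rewrite /= ?mulr1 ?mulr0 ?eqxx.
rewrite /faces !finset.in_setU.
have [r0|r0] := eqVneq r 0.
  suff -> : supp (edge_curve s) = [set x]%SET by rewrite imset_f.
  by apply/setP => v; rewrite suppE inE r0 eqxx /= andbF orbF [0 == 1]eq_sym oner_eq0 andbT.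
have [r1|r1] := eqVneq r 1.
  suff -> : supp (edge_curve s) = [set y]%SET by rewrite imset_f.
  by apply/setP => v; rewrite suppE inE r1 eqxx /= andbF oner_eq0 andbT.
suff -> : supp (edge_curve s) = [set x; y]%SET.
  apply/orP; left; apply/orP; right; rewrite inE; apply/existsP; exists x.
  by apply/existsP; exists y; rewrite xy eqxx.
by apply/setP => v; rewrite suppE !inE r0 r1 !andbT.
Qed.

End EdgePath.

End Curves.

(** * Edge paths joining opposite sides of the quadrilateral *)

Section Cross.
Variables (R : realType) (V : finType) (T : quad_triangulation R V).

Lemma realization_vertex (v : V) :
  realization (adj T) (tris T) (vertex_point R v).
Proof.
split=> [w||].
- by rewrite /vertex_point ler0n.
- rewrite /vertex_point (bigD1 v) //= eqxx big1 ?addr0 // => w.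
  by move=> /negbTE ->.
- rewrite /faces !finset.in_setU.
  suff -> : supp (vertex_point R v) = [set v]%SET by rewrite imset_f.
  apply/setP => w; rewrite !inE /vertex_point.
  by case: (w == v); rewrite ?oner_eq0 ?eqxx.
Qed.

Lemma vertex_point_inj : injective (@vertex_point R V).
Proof.
move=> v w /(congr1 (fun h => h v)); rewrite /vertex_point eqxx.
by case: eqP => // _ /eqP; rewrite oner_eq0.
Qed.

Lemma side_neq (i j : 'I_4) (v w : V) :
  v \in side T i -> w \in side T j -> i != j -> v != w.
Proof.
move=> vi wj /(side_disjoint T) dij; apply/eqP => e.
by move: dij; rewrite disjoint_subset => /fintype.subsetP /(_ _ vi); rewrite e inE wj.
Qed.

Lemma quad_paths_cross (x0 y0 : V) (p q : seq V) :
  path (adj T) x0 p -> x0 \in P3 T -> last x0 p \in P1 T ->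
  path (adj T) y0 q -> y0 \in P2 T -> last y0 q \in P4 T ->
  exists2 v, v \in x0 :: p & v \in y0 :: q.
Proof.
move=> pp x3 x1 pq y2 y4.
have [kt [[ct _] tQ _ ktK _]] := tri_mapP T.
have [kd [[cd ckd] dQ kdD dK kdK]] := disk_mapP T.
have size_gt0 (z : V) (r : seq V) (i j : 'I_4) :
    z \in side T i -> last z r \in side T j -> i != j -> (0 < size r)%N.
  case: r => //= zi zj ij; have := side_neq zi zj ij; by rewrite eqxx.
have np : (0 < size p)%N by apply: size_gt0 x3 x1 _.
have nq : (0 < size q)%N by apply: size_gt0 y2 y4 _.
(* The path is pulled back to the unit disk, with time rescaled to [[0, 1]] and clamped, so that the
   curve rests at its endpoints outside this interval. *)
have curve (z : V) (r : seq V) : path (adj T) z r -> (0 < size r)%N ->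
    exists f : R -> R * R, [/\ continuous f, forall s, unit_disk (f s),
      f 0 = kd (tri_map T (vertex_point R z)),
      f 1 = kd (tri_map T (vertex_point R (last z r))) &
      forall s, 0 <= s <= 1 -> exists w, [/\ realization (adj T) (tris T) w,
        f s = kd (tri_map T w) & forall v, w v != 0 -> v \in z :: r]].
  move=> pr nr; pose n : R := (size r)%:R; have n0 : 0 <= n by rewrite ler0n.
  pose W s := edge_curve z r (clamp n (n * s)).
  have Wr s : realization (adj T) (tris T) (W s).
    by apply: edge_curve_realization => //; [exact: adj_irr|exact: clamp_itv].
  have cW : continuous W.
    move=> s; have c1 : clamp n (n * r) @[r --> s] --> clamp n (n * s).
      have c2 : n * r @[r --> s] --> n * s.
        by apply: cvgM; [exact: cvg_cst|exact: cvg_id].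
      exact: cvg_comp c2 (@clamp_continuous _ _ _).
    exact: cvg_comp c1 (@edge_curve_continuous _ _ _ _ _).
  have cf1 := continuous_comp_within cW Wr ct.
  have q1 s : quad T ((tri_map T \o W) s) by apply: tQ.
  have cf2 := continuous_comp_within cf1 q1 ckd.
  exists (kd \o (tri_map T \o W)); split=> //.
  - by move=> s; apply: kdD; exact: q1.
  - by rewrite /= /W mulr0 clamp_id ?lexx //; rewrite (@edge_curve_vertex _ _ _ _ 0).
  - rewrite /= /W mulr1 clamp_id ?lexx ?n0 // edge_curve_vertex //.
    by rewrite -last_nth.
  - by move=> s hs; exists (W s); split=> // v; apply: edge_curve_supp.
have [f [cf df f0 f1 sf]] := curve _ _ pp np.
have [h [ch dh h0 h1 sh]] := curve _ _ pq nq.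
pose b t := kd (bd_loop T (clamp 4 t)).
have four : 0 <= 4 :> R by [].
have clamp04 t : `[0, 4]%classic (clamp (4 : R) t).
  by rewrite /= in_itv /= clamp_itv.
have bdE t : exists2 z, unit_circle z & disk_map T z = bd_loop T (clamp 4 t).
  have : (bd_loop T @` `[0, 4]) (bd_loop T (clamp 4 t)) by exists (clamp 4 t).
  by rewrite bd_loop_image.
have circ_disk (z : R * R) : unit_circle z -> unit_disk z.
  by rewrite /unit_circle /unit_disk /= => ->.
have bdQ t : quad T (bd_loop T (clamp 4 t)).
  by have [z /circ_disk hz <-] := bdE t; exact: dQ.
have loop : circle_loop b.
  split.
  - have cb : continuous (fun t => bd_loop T (clamp 4 t)).
      exact: (continuous_comp_within (@clamp_continuous R 4) clamp04 (bd_loop_cont (q := T))).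
    exact: continuous_comp_within cb bdQ ckd.
  - by move=> t; rewrite /b; have [z hz <-] := bdE t; rewrite dK //; exact: circ_disk.
  - move=> s t hs ht /(congr1 (disk_map T)); rewrite !kdK //.
    have cl u : 0 <= u < 4 -> clamp 4 u = u :> R.
      by move=> /andP [u0 u4]; rewrite clamp_id // u0 ltW.
    rewrite !cl //; apply: bd_loop_inj; by rewrite inE /= in_itv.
  - by rewrite /b !clamp_id ?lexx ?four // bd_loop_closed.
  - move=> z hz; have : (disk_map T @` @unit_circle R) (disk_map T z) by exists z.
    rewrite -bd_loop_image => -[t /= tI e]; exists t; first by move: tI; rewrite in_itv.
    rewrite /b clamp_id; last by move: tI; rewrite in_itv.
    by rewrite e dK //; exact: circ_disk.
have on_side (i : 'I_4) v : v \in side T i ->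
    exists2 t : R, i%:R <= t <= i%:R + 1 & kd (tri_map T (vertex_point R v)) = b t.
  move=> /(side_arc (q := T)) [t /=]; rewrite in_itv /= => hi e.
  rewrite -[i.+1]addn1 natrD in hi.
  exists t => //; rewrite /b clamp_id ?e //.
  have : (i + 1)%N%:R <= 4%:R :> R by rewrite ler_nat addn1 ltn_ord.
  have : 0 <= (i : nat)%:R :> R by [].
  by rewrite natrD; lra.
have neq (i j : 'I_4) v w : v \in side T i -> w \in side T j -> i != j ->
    kd (tri_map T (vertex_point R v)) != kd (tri_map T (vertex_point R w)).
  move=> vi wj ij; apply: contraNneq (side_neq vi wj ij).
  have rv := realization_vertex.
  move=> /(congr1 (disk_map T)); rewrite !kdK; try by apply: tQ.
  by move=> /(congr1 kt); rewrite !ktK // => /vertex_point_inj ->.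
have [t1 i1 b1] := on_side _ _ x1; have [t2 i2 b2] := on_side _ _ y2.
have [t3 i3 b3] := on_side _ _ x3; have [t4 i4 b4] := on_side _ _ y4.
(* Consecutive closed arcs share a corner, so strict order of the parameters comes from the
   disjointness of the vertex sets; [n14] excludes [t1 = 0] together with [t4 = 4]. *)
have n12 : t1 != t2 by apply: contraTneq (neq _ _ _ _ x1 y2 isT) => e; rewrite b1 b2 e eqxx.
have n23 : t2 != t3 by apply: contraTneq (neq _ _ _ _ y2 x3 isT) => e; rewrite b2 b3 e eqxx.
have n34 : t3 != t4 by apply: contraTneq (neq _ _ _ _ x3 y4 isT) => e; rewrite b3 b4 e eqxx.
have n14 : b t1 != b t4 by rewrite -b1 -b4; apply: neq x1 y4 isT.
rewrite /= in i1 i2 i3 i4.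
have t10 : 0 <= t1 by case/andP: i1.
have t12 : t1 < t2 by rewrite lt_neqAle n12; lra.
have t23 : t2 < t3 by rewrite lt_neqAle n23; lra.
have t34 : t3 < t4 by rewrite lt_neqAle n34; lra.
have t44 : t4 <= 4 by lra.
have f0' : f 0 = b t3 by rewrite f0 b3.
have f1' : f 1 = b t1 by rewrite f1 b1.
have h0' : h 0 = b t2 by rewrite h0 b2.
have h1' : h 1 = b t4 by rewrite h1 b4.
have [s [t [hs ht e]]] :=
  disk_crossing loop t10 t12 t23 t34 t44 n14 cf ch df dh f0' f1' h0' h1'.
have [w [rw fw wp]] := sf s hs; have [w' [rw' hw' wq]] := sh t ht.
have ww : w = w'.
  move: e; rewrite fw hw' => /(congr1 (disk_map T)); rewrite !kdK; try by apply: tQ.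
  by move=> /(congr1 kt); rewrite !ktK.
have [v wv] : exists v, w v != 0.
  apply: contrapT => nv; case: rw => _ + _; rewrite big1 => [/eqP|v _].
    by rewrite eq_sym oner_eq0.
  by apply: contrapT => /eqP wv; apply: nv; exists v.
by exists v; [exact: wp|apply: wq; rewrite -ww].
Qed.

End Cross.

(** * Energy and lengths *)

Section Network.
Variables (R : realType) (V : finType) (T : quad_triangulation R V).

Lemma nadj_sym : symmetric (nadj T).
Proof. by move=> x y; rewrite /nadj /= adj_sym orbC. Qed.

Lemma nadj_adj : subrel (nadj T) (adj T).
Proof. by move=> x y /andP []. Qed.

(* Only the part strictly between the endpoints is shortened, with its first
   and last vertices kept, as condition (5) refers to them. *)
Lemma thick_path_shorten (A B D : {set V}) (x0 : V) (p : seq V) :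
  thick_path T A B D x0 p ->
  exists2 p', thick_path T A B D x0 p' & (size p' <= #|V|.+1)%N.
Proof.
case: p => [|y p] thp; first by exists [::].
case/lastP: p thp => [|p z] thp.
  by exists [:: y] => //; rewrite /= ltnS; apply/card_gt0P; exists y.
pose b s := x0 :: y :: rcons s z.
have N s i : (i <= size s)%N -> nth x0 (b s) i.+1 = nth x0 (y :: s) i.
  by move=> le; rewrite /b /= -rcons_cons nth_rcons /= ltnS le.
have Nl s : nth x0 (b s) (size (y :: rcons s z)) = z.
  by rewrite -last_nth /= last_rcons.
have Np s : nth x0 (b s) (size (y :: rcons s z)).-1 = last y s.
  by rewrite /= size_rcons N // -last_nth.
have szb s : size (y :: rcons s z) = (size s).+2 by rewrite /= size_rcons.
have memb s v : (v \in b s) = [|| v == x0, v \in y :: s | v == z].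
  by rewrite /b !inE mem_rcons !inE; case: (v == x0); case: (v == y); rewrite //= orbC.
case: thp => [pth]; rewrite -/(b p) Nl Np.
move=> [[hA hB] [hc [hF [h4 h5]]]].
move: pth; rewrite /= rcons_path => /and3P [x0y py lz].
have [p' [py' uy' sub lastE]] : exists p',
    [/\ path (nadj T) y p', uniq (y :: p'), {subset p' <= p} &
        last y p' = last y p].
  by case/shortenP: py => p' py' uy' sub; exists p'.
rewrite -lastE in lz h5.
have sub' v : v \in y :: p' -> v \in y :: p.
  by rewrite !inE => /orP [-> //|/sub ->]; rewrite orbT.
have subb v : v \in b p' -> v \in b p.
  by rewrite !memb => /or3P [->|/sub' ->|->]; rewrite ?orbT.
exists (y :: rcons p' z); last first.
  by rewrite /= size_rcons ltnS -[(size p').+1]/(size (y :: p')) -(card_uniqP uy') max_card.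
split; first by rewrite /= rcons_path x0y py' lz.
rewrite -/(b p') Nl Np; split; last split=> //; last split; last split=> //.
- split=> v.
    split=> [[/subb vb vA]|->]; first by apply/hA.
    by split; [rewrite memb eqxx|have /hA [] : x0 = x0 by []].
  split=> [[/subb vb vB]|->]; first by apply/hB.
  by split; [rewrite memb eqxx !orbT|have /hB [] : z = z by []].
- move=> [//|i] _; rewrite szb addn1 !ltnS => lei.
  rewrite N //; have : nth x0 (y :: p') i \in y :: p' by rewrite mem_nth.
  move=> /sub' /(nthP x0) [j ltj <-]; rewrite -N //.
  by apply: hF; rewrite // szb addn1.
- move=> [//|[//|i]] _; rewrite szb addn2 !ltnS => lti.
  rewrite (N _ i.+1 (ltnW lti)).
  have : nth x0 (y :: p') i.+1 \in y :: p' by rewrite mem_nth //= ltnS ltnW.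
  move=> /sub' /(nthP x0) [j ltj ej].
  (* As [y :: p'] has no repetition, its inner vertices differ from both of its ends, so they come
     from inner positions of the original path, where condition (4) applies. *)
  have j0 : j != 0%N.
    apply: contraTneq uy' => j0; move: ej; rewrite j0 /= => ->.
    by rewrite mem_nth // ltnW.
  have jl : j != size p.
    apply/eqP => jl; move: ej; rewrite jl -last_nth -lastE (last_nth x0) => /eqP.
    by rewrite nth_uniq //= ?ltnS ?(ltnW lti) // gtn_eqF.
  rewrite -ej -N //; apply: h4; last by rewrite szb; move: ltj jl => /=; lia.
  by case: (j) j0.
Qed.

End Network.

(** * Dirichlet energy, flows and the gradient metric *)

Section Energy.
Variables (R : realType) (V : finType) (T : quad_triangulation R V).
Variable c : V -> V -> R.
Hypothesis c_cond : conductance T c.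

Local Notation nadj := (nadj T).

Lemma conductance_sym x y : nadj x y -> c x y = c y x.
Proof. by move=> /nadj_adj /c_cond []. Qed.

Lemma conductance_gt0 x y : nadj x y -> 0 < c x y.
Proof. by move=> /nadj_adj /c_cond []. Qed.

Lemma norm_conductanceE x :
  norm_at T c x (conductance_vector c x) = Num.sqrt (\sum_(y | nadj x y) c x y).
Proof.
rewrite /norm_at /inner_at; congr Num.sqrt; apply: eq_bigr => y xy.
by rewrite /conductance_vector mulfK // gt_eqF // conductance_gt0.
Qed.

Lemma gradient_metricE f x : gradient_metric T c f x =
  Num.sqrt (\sum_(y | nadj x y) c x y * (f x - f y) ^+ 2).
Proof.
rewrite /gradient_metric /norm_at /inner_at.
by case: ifP => _; congr Num.sqrt; apply: eq_bigr => y xy;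
  have c0 := conductance_gt0 xy; rewrite /df_vector /dn_vector; field; rewrite gt_eqF.
Qed.

Lemma gradient_metric_ge0 f x : 0 <= gradient_metric T c f x.
Proof. by rewrite gradient_metricE sqrtr_ge0. Qed.

Lemma sum_conductance_sqr_ge0 f x :
  0 <= \sum_(y | nadj x y) c x y * (f x - f y) ^+ 2.
Proof.
by rewrite sumr_ge0 // => y xy; rewrite mulr_ge0 ?sqr_ge0 // ltW // conductance_gt0.
Qed.

Lemma energy_ge0 f : 0 <= energy T c f.
Proof.
by rewrite mulr_ge0 ?invr_ge0 // sumr_ge0 // => x _; exact: sum_conductance_sqr_ge0.
Qed.

(** The squared metric at [x] is one row of the sum over ordered pairs, and that sum is twice the
    energy. *)
Lemma gradient_metric_le_energy f x :
  gradient_metric T c f x <= Num.sqrt (2 * energy T c f).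
Proof.
rewrite gradient_metricE ler_wsqrtr // /energy mulVKf ?pnatr_eq0 //.
rewrite [leRHS](bigD1 x) //= lerDl sumr_ge0 // => y _.
exact: sum_conductance_sqr_ge0.
Qed.

Lemma gradient_metric_edge f x y : nadj x y ->
  Num.sqrt (c x y) * `|f x - f y| <= gradient_metric T c f x.
Proof.
move=> xy; have c0 : 0 <= c x y by rewrite ltW // conductance_gt0.
rewrite gradient_metricE -sqrtr_sqr -sqrtrM //.
rewrite ler_wsqrtr // (bigD1 y) //= lerDl sumr_ge0 // => z /andP [xz _].
by rewrite mulr_ge0 ?sqr_ge0 // ltW // conductance_gt0.
Qed.

Lemma gradient_metric_flow f x :
  \sum_(y | nadj x y) c x y * `|f x - f y| <=
  norm_at T c x (conductance_vector c x) * gradient_metric T c f x.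
Proof.
rewrite norm_conductanceE gradient_metricE.
set S := \sum_(y | nadj x y) c x y; set Q := \sum_(y | nadj x y) _ * _ ^+ 2.
set L := \sum_(y | nadj x y) _.
have c0 y : nadj x y -> 0 <= c x y by move=> xy; rewrite ltW // conductance_gt0.
have S0 : 0 <= S by apply: sumr_ge0.
have Q0 : 0 <= Q by exact: sum_conductance_sqr_ge0.
have L0 : 0 <= L by apply: sumr_ge0 => y xy; rewrite mulr_ge0 // c0.
rewrite -sqrtrM // -(ger0_norm L0) -sqrtr_sqr ler_wsqrtr //.
have [S00|Sn0] := eqVneq S 0.
  suff -> : L = 0 by rewrite S00 mul0r expr0n.
  rewrite /L big1 // => y xy.
  move/psumr_eq0P : S00 => /(_ c0 y xy) ->; rewrite mul0r //.
(* Cauchy-Schwarz with weights [c x y], as the nonnegativity of a variance. *)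
have : 0 <= \sum_(y | nadj x y) c x y * (S * `|f x - f y| - L) ^+ 2.
  by apply: sumr_ge0 => y xy; rewrite mulr_ge0 ?sqr_ge0 // c0.
have -> : \sum_(y | nadj x y) c x y * (S * `|f x - f y| - L) ^+ 2 =
    S * (S * Q - L ^+ 2).
  under eq_bigr => y xy.
    rewrite (_ : _ * _ = S ^+ 2 * (c x y * (f x - f y) ^+ 2) -
       2 * S * L * (c x y * `|f x - f y|) + L ^+ 2 * c x y); last first.
      by rewrite -[(f x - f y) ^+ 2]real_normK ?num_real //; ring.
    over.
  rewrite big_split /= sumrB -!mulr_sumr -/S -/L -/Q; ring.
by rewrite pmulr_rge0 ?subr_ge0 // lt_def Sn0.
Qed.

(** The differences along the path telescope, each edge being charged to its first vertex. *)
Lemma path_length_ge f (m : R) x p : lbound (sqrt_conductances T c) m ->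
  path nadj x p ->
  m * `|f x - f (last x p)| <= rho_length (gradient_metric T c f) (x :: p).
Proof.
move=> hm; have m_edge y z : nadj y z -> m * `|f y - f z| <= gradient_metric T c f y.
  move=> yz; apply: le_trans (gradient_metric_edge f yz).
  by apply: ler_wpM2r => //; apply: hm; exists y, z.
rewrite /rho_length; elim: p x => [|y p IH] x /=.
  by move=> _; rewrite subrr normr0 mulr0 big_seq1 gradient_metric_ge0.
move=> /andP [xy /IH {}IH]; rewrite big_cons.
have [m0|m0] := ltP m 0.
  apply: le_trans (addr_ge0 (gradient_metric_ge0 f x) (sumr_ge0 _ _)).
    by rewrite nmulr_rle0.
  by move=> z _; exact: gradient_metric_ge0.
apply: le_trans (lerD (m_edge _ _ xy) IH).
rewrite -mulrDr ler_wpM2l // (le_trans _ (ler_normD _ _)) //.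
by rewrite subrKA.
Qed.

Lemma rho_length_le (rho : V -> R) (K : R) (s : seq V) :
  (forall x, rho x <= K) -> rho_length rho s <= (size s)%:R * K.
Proof.
move=> le; rewrite /rho_length; elim: s => [|x s IH].
  by rewrite big_nil mul0r.
by rewrite big_cons /= -addn1 natrD addrC mulrDl mul1r lerD.
Qed.

(** A path may revisit a vertex; its length counts every visit, the flow through its vertex set only
    one. *)
Lemma sum_mem_le (h : V -> R) (s : seq V) : (forall x, 0 <= h x) ->
  \sum_(x in s) h x <= \sum_(x <- s) h x.
Proof.
move=> h0; rewrite (eq_bigl (mem (undup s))) => [|x]; last by rewrite /= mem_undup.
rewrite -big_uniq ?undup_uniq //.
elim: s => [|x s IH] /=; first by rewrite !big_nil.
case: ifP => _; rewrite !big_cons ?lerD //.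
by apply: le_trans IH _; rewrite lerDr.
Qed.

(* The edges inside [S] cancel, and every edge leaving [S] ends on [s]. *)
Lemma flux_le_length f (M : R) (S : {set V}) (s : seq V) :
  (forall x, norm_at T c x (conductance_vector c x) <= M) ->
  (forall x y, x \in S -> y \notin S -> nadj x y -> y \in s) ->
  \sum_(x in S) laplacian T c f x <=
  M * rho_length (gradient_metric T c f) s.
Proof.
move=> hM cut; pose h x y : R := if nadj x y then c x y * (f x - f y) else 0.
have lapE x : laplacian T c f x = \sum_y h x y.
  by rewrite /laplacian big_mkcond.
have hN x y : h y x = - h x y.
  rewrite /h nadj_sym; case: ifP => xy; rewrite ?oppr0 //.
  by rewrite (conductance_sym xy); ring.
have inner0 : \sum_(x in S) \sum_(y in S) h x y = 0.
  set I := LHS; have : I = - I.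
    rewrite {1}/I exchange_big /= /I -sumrN; apply: eq_bigr => x _.
    by rewrite -sumrN; apply: eq_bigr => y _; rewrite hN.
  lra.
under eq_bigr => x _ do rewrite lapE (bigID (mem S)) /=.
rewrite big_split /= inner0 add0r.
have bound x : \sum_(y | nadj x y) c x y * `|f x - f y| <= M * gradient_metric T c f x.
  apply: le_trans (gradient_metric_flow f x) _.
  by rewrite ler_wpM2r // gradient_metric_ge0.
rewrite /rho_length mulr_sumr.
apply: le_trans (_ : \sum_(y in s) \sum_(x | nadj y x) c y x * `|f y - f x| <= _);
  last first.
  apply: le_trans (ler_sum _ _) (sum_mem_le _ _) => [y _|y]; first exact: bound.
  by apply: le_trans (bound y); apply: sumr_ge0 => x xy;
     rewrite mulr_ge0 // ltW // conductance_gt0.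
(* The flow out of [S] is regrouped by outer endpoint; endpoints off [s] contribute nothing by
   [cut]. *)
rewrite exchange_big /= [leLHS](bigID (mem s)) /= [X in _ + X]big1 ?addr0; last first.
  move=> y /andP [yS ys]; apply: big1 => x xS; rewrite /h; case: ifP => // xy.
  by move: ys; rewrite (cut x).
apply: (@le_trans _ _ (\sum_(y in s) \sum_x `|h x y|)).
  rewrite [leRHS](bigID [pred y | y \notin S]) /=.
  rewrite [X in X + _](eq_bigl (fun y => (y \notin S) && (y \in s))); last first.
    by move=> y; rewrite andbC.
  apply: ler_wpDr; first by apply: sumr_ge0 => y _; apply: sumr_ge0.
  apply: ler_sum => y _; rewrite [leRHS](bigID (mem S)) /=.
  apply: ler_wpDr; first by apply: sumr_ge0.
  by apply: ler_sum => x _; exact: ler_norm.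
apply: ler_sum => y _; rewrite [leRHS]big_mkcond; apply: ler_sum => x _.
rewrite /h nadj_sym; case: ifP => yx; last by rewrite normr0.
by rewrite normrM gtr0_norm ?conductance_gt0 1?nadj_sym // distrC conductance_sym 1?nadj_sym.
Qed.

(** Summation by parts: the flow [h] is antisymmetric, so the two halves of [(f x - f y) * h x y]
    have equal sums. *)
Lemma energy_green f : energy T c f = \sum_x f x * laplacian T c f x.
Proof.
pose h x y : R := if nadj x y then c x y * (f x - f y) else 0.
have hN x y : h y x = - h x y.
  rewrite /h nadj_sym; case: ifP => xy; rewrite ?oppr0 //.
  by rewrite (conductance_sym xy); ring.
have -> : energy T c f = 2^-1 * \sum_x \sum_y (f x - f y) * h x y.
  congr (_ * _); apply: eq_bigr => x _; rewrite big_mkcond; apply: eq_bigr => y _.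
  by rewrite /h; case: ifP => _; ring.
have -> : \sum_x f x * laplacian T c f x = \sum_x \sum_y f x * h x y.
  apply: eq_bigr => x _; rewrite mulr_sumr big_mkcond; apply: eq_bigr => y _.
  by rewrite /h; case: ifP => // _; rewrite mulr0.
set G := RHS.
have -> : \sum_x \sum_y (f x - f y) * h x y = G - \sum_x \sum_y f y * h x y.
  rewrite /G -sumrB; apply: eq_bigr => x _; rewrite -sumrB.
  by apply: eq_bigr => y _; rewrite mulrBl.
have -> : \sum_x \sum_y f y * h x y = - G.
  rewrite exchange_big /G -sumrN; apply: eq_bigr => y _; rewrite -sumrN.
  by apply: eq_bigr => x _; rewrite hN mulrN.
by field.
Qed.

End Energy.

(** * Flux and length bounds for thick paths *)

Section Bounds.
Variables (R : realType) (V : finType) (T : quad_triangulation R V).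
Hypothesis deltaE : deltaF T = (P1 T :|: P2 T :|: P3 T :|: P4 T)%SET.
Variable c : V -> V -> R.
Hypothesis c_cond : conductance T c.

(** A boundary vertex lies on some side by [side_cover]. Hence sums over [V] are sums over
    [barF]. *)
Lemma F_or_deltaF (x : V) : x \in F T \/ x \in deltaF T.
Proof.
have [xF|] := boolP (x \in F T); [by left|rewrite inE negbK => /asboolP bx].
right; have [i xi] := side_cover bx; rewrite deltaE !inE /P1 /P2 /P3 /P4.
have : i \in enum 'I_4 by rewrite mem_enum.
case: i xi => [] [|[|[|[|//]]]] lti; rewrite (bool_irrelevance lti isT) => -> _;
  by rewrite ?orbT.
Qed.

Lemma length_le_energy f (A B D : {set V}) (x0 : V) (p : seq V) :
  shortest (thick_path T A B D) (gradient_metric T c f) x0 p ->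
  rho_length (gradient_metric T c f) (x0 :: p) <=
  (#|V| + 2)%N%:R * Num.sqrt (2 * energy T c f).
Proof.
move=> [/thick_path_shorten [p' thp' sp'] /(_ x0 p' thp')] le.
apply: le_trans le _; apply: le_trans (rho_length_le _ _) _.
  by move=> x; apply: gradient_metric_le_energy.
by rewrite ler_wpM2r ?sqrtr_ge0 // ler_nat /= addn2 ltnS.
Qed.

Lemma thick_endpoints (A B D : {set V}) x0 p : thick_path T A B D x0 p ->
  [/\ path (nadj T) x0 p, x0 \in A & last x0 p \in B].
Proof.
move=> [pth [[hA hB] _]]; split=> //.
  by have /hA [] : x0 = nth x0 (x0 :: p) 0 by [].
by rewrite (last_nth x0); have /hB [] := erefl (nth x0 (x0 :: p) (size p)).
Qed.

Variables (g : R) (f : V -> R).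
Hypothesis hf : DN_boundary_value_function T c g f.

(** A boundary vertex has network neighbors only in [F], so its Laplacian is its normal derivative,
    which vanishes on [P1] and [P3]. *)
Lemma laplacian_eq0 x : x \notin P2 T -> x \notin P4 T -> laplacian T c f x = 0.
Proof.
case: hf => _ [harm [_ [_ neu]]] x2 x4.
have [/harm //|] := F_or_deltaF x.
move=> xd; have x13 : x \in (P1 T :|: P3 T)%SET.
  by move: xd; rewrite deltaE !inE (negbTE x2) (negbTE x4) !orbF.
have xF : x \notin F T by move: xd; rewrite inE => /andP [].
rewrite -(neu x x13) /laplacian /normal_derivative; apply: eq_bigl => y.
by rewrite /nadj /= (negbTE xF) /=; case: (y \in F T); rewrite ?andbT ?andbF.
Qed.

Lemma energy_flux : energy T c f = g * \sum_(x in P4 T) laplacian T c f x.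
Proof.
case: (hf) => _ [_ [f2 [f4 _]]].
rewrite energy_green // (bigID (mem (P4 T))) /= [X in _ + X]big1 ?addr0.
  by rewrite mulr_sumr; apply: eq_bigr => x x4; rewrite f4.
move=> x x4; have [x2|x2] := boolP (x \in P2 T); first by rewrite f2 ?mul0r.
by rewrite laplacian_eq0 ?mulr0.
Qed.

(** Let [S] be what [P4] reaches without touching the path. By the crossing result [S] misses [P2],
    so the Laplacian vanishes on [S] off [P4] and the flux is that out of [S], whose outgoing edges
    all end on the path. *)
Lemma flux_le_vertical_length (M : R) y0 q :
  ubound (conductance_norms T c) M -> vertically_thick T y0 q ->
  \sum_(x in P4 T) laplacian T c f x <=
  M * rho_length (gradient_metric T c f) (y0 :: q).
Proof.
move=> hM thq; have [pq y3 q1] := thick_endpoints thq.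
have hM' x : norm_at T c x (conductance_vector c x) <= M.
  by apply: hM; case: (F_or_deltaF x) => ?; [left|right]; exists x.
pose e : rel V := [rel x y | [&& nadj T x y, x \notin y0 :: q & y \notin y0 :: q]].
have esym : connect_sym e.
  by apply: sym_connect_sym => x y; rewrite /e /= nadj_sym [(x \notin _) && _]andbC.
pose S := [set x | [exists z in P4 T, connect e x z]]%SET.
have adj_path x r : path (nadj T) x r -> path (adj T) x r.
  by apply: sub_path; exact: nadj_adj.
have S2 x : x \in S -> x \notin P2 T.
  rewrite inE => /existsP [z /andP [z4 /connectP [r pr zr]]].
  apply/negP => x2.
  have pr' : path (nadj T) x r by apply: sub_path pr => a b /andP [].
  rewrite zr in z4.
  have [v vq] := quad_paths_cross (adj_path _ _ pq) y3 q1 (adj_path _ _ pr') x2 z4.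
  case: r pr {pr' zr} z4 => [_ x4|w r pr _].
    by have := side_neq x2 x4 isT; rewrite eqxx.
  rewrite inE => /orP [/eqP vx|vr].
    by case/andP: pr => /and3P [_ xq _] _; rewrite -vx vq in xq.
  have : all (fun v => v \notin y0 :: q) (w :: r).
    elim: (w :: r) (x) pr => //= a l IH b /andP [/and3P [_ _ ->] /IH ->] //.
  by move=> /allP /(_ v vr); rewrite vq.
have S4 x : x \in P4 T -> x \in S.
  by move=> x4; rewrite inE; apply/existsP; exists x; rewrite x4 connect0.
(* The ends of the path lie on [P3] and [P1], and its inner vertices in [F]. *)
have inq x : x \in P4 T -> x \notin y0 :: q.
  move=> x4; apply/negP => /(nthP y0) [i lti ei].
  move: thq => [_ [_ [_ [hF _]]]].
  have [i0|i0] := posnP i.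
    by have := side_neq y3 x4 isT; rewrite -ei i0 eqxx.
  have [iq|iq] := ltnP i (size q); last first.
    have ie : i = size q by apply/eqP; rewrite eqn_leq iq -ltnS lti.
    by move: q1; rewrite (last_nth y0) -ie ei => q1; have := side_neq q1 x4 isT; rewrite eqxx.
  have := hF i i0; rewrite addn1 ei => /(_ iq) xF.
  have : x \in deltaF T by rewrite deltaE !inE x4 !orbT.
  by rewrite inE xF.
have Sq x : x \in S -> x \notin y0 :: q.
  rewrite inE => /existsP [z /andP [z4 /connectP [r pr zr]]].
  case: r pr zr => [_ /= zx|w r /= /andP [/and3P [] //]].
  by rewrite -zx inq.
have -> : \sum_(x in P4 T) laplacian T c f x = \sum_(x in S) laplacian T c f x.
  rewrite [RHS](bigID (mem (P4 T))) /= [X in _ + X]big1 ?addr0.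
    by apply: eq_bigl => x; case: (boolP (x \in P4 T)) => [/S4 ->|]; rewrite ?andbF.
  by move=> x /andP [/S2 x2 x4]; apply: laplacian_eq0.
apply: flux_le_length => // x y xS yS xy; apply: contraNT yS => yq.
move: (xS); rewrite !inE => /existsP [z /andP [z4 xz]]; apply/existsP; exists z.
rewrite z4 /=; apply: connect_trans xz; apply: connect1.
by rewrite /e /= nadj_sym xy yq Sq.
Qed.

Lemma horizontal_length_ge (m : R) x0 p : 0 < g ->
  lbound (sqrt_conductances T c) m -> horizontally_thick T x0 p ->
  m * g <= rho_length (gradient_metric T c f) (x0 :: p).
Proof.
move=> g0 hm thp; have [pp x2 p4] := thick_endpoints thp.
have := path_length_ge c_cond f hm pp.
case: hf => _ [_ [f2 [f4 _]]]; rewrite f2 // f4 // sub0r normrN gtr0_norm //.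
Qed.

End Bounds.

Theorem corollary3p7 (R : realType) :
  exists l : nat -> R, (forall k, 0 < l k) /\
  forall (V : finType) (T : quad_triangulation R V),
    deltaF T = (P1 T :|: P2 T :|: P3 T :|: P4 T)%SET ->
  forall c : V -> V -> R, conductance T c ->
  forall g : R, 0 < g ->
  forall f : V -> R, DN_boundary_value_function T c g f ->
  forall M : R,
    conductance_norms T c M -> ubound (conductance_norms T c) M ->
  forall m : R,
    sqrt_conductances T c m -> lbound (sqrt_conductances T c) m ->
  forall (y0 : V) (q : seq V),
    shortest (vertically_thick T) (gradient_metric T c f) y0 q ->
  forall (x0 : V) (p : seq V),
    shortest (horizontally_thick T) (gradient_metric T c f) x0 p ->
  let L := rho_length (gradient_metric T c f) (y0 :: q) *
           rho_length (gradient_metric T c f) (x0 :: p) in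
  l #|V| * energy T c f >= L /\ L >= m / M * energy T c f.
Proof.
(* Each of the two lengths is at most [|V| + 2] times the square root of twice the energy. *)
exists (fun k => 2 * (k + 2)%N%:R ^+ 2); split=> [k|].
  by rewrite mulr_gt0 // exprn_gt0 // ltr0n addn2.
move=> V T dE c cc g g0 f hf M Mn hM m mc hm y0 q sq x0 p sp L.
have len0 s : 0 <= rho_length (gradient_metric T c f) s.
  by apply: sumr_ge0 => x _; exact: gradient_metric_ge0.
split.
  have := ler_pM (len0 _) (len0 _) (length_le_energy cc sq) (length_le_energy cc sp).
  congr (_ <= _); set E := energy T c f.
  have E0 : 0 <= 2 * E by rewrite mulr_ge0 // energy_ge0.
  rewrite mulrACA -[_ * Num.sqrt _]expr2 sqr_sqrtr //; ring.
have flux := flux_le_vertical_length dE cc hf hM sq.1.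
have len := horizontal_length_ge cc hf g0 hm sp.1.
have M0 : 0 <= M by case: Mn => [] [x _ <-]; exact: sqrtr_ge0.
have m0 : 0 <= m by case: mc => x [y [_ ->]]; exact: sqrtr_ge0.
(* Division by 0 yields 0, so the lower bound is trivial when [M = 0]. *)
have [Mz|Mz] := eqVneq M 0; first by rewrite Mz invr0 mulr0 mul0r mulr_ge0.
have Mp : 0 < M by rewrite lt_def Mz.
rewrite (energy_flux dE cc hf) mulrAC ler_pdivrMr //.
rewrite /L; set P := \sum_(x in P4 T) _ in flux *.
rewrite mulrCA mulrA [leRHS]mulrAC [_ * M]mulrC [g * m * P]mulrC [g * m]mulrC.
apply: (@le_trans _ _ (M * rho_length (gradient_metric T c f) (y0 :: q) * (m * g))).
  by apply: ler_wpM2r => //; rewrite mulr_ge0 // ltW.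
by apply: ler_wpM2l => //; rewrite mulr_ge0.
Qed.
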